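(* For $n\in\mathbb{N}$, $b\in\mathbb{R}\setminus(-n,0)$ and $c\ge0$ let $$P_n(x;b,c)=\sum_{k=0}^n(-1)^{n-k}\binom nk|k+b|^c\,x^k.$$ Fix $\beta\in\mathbb{R}\setminus(-1,0)$ and $\gamma>0$. Let $(b_n)_{n\in\mathbb{N}}\subseteq\mathbb{R}$ and $(c_n)_{n\in\mathbb{N}}\subseteq\mathbb{N}_0$ be sequences such that $b_n/n\to\beta$ and $c_n/n\to\gamma$ as $n\to\infty$. Let also $b_n\in\mathbb{R}\setminus(-n,0)$ for every $n\in\mathbb{N}$. Then $[\![P_n(x;b_n,c_n)]\!]_n$ converges weakly, as $n\to\infty$, to a probability measure $\nu=\nu_{\beta,\gamma}$ on $[0,\infty)$ with $$S_\nu(t)=e^{\frac{\gamma}{t+\beta+1}},\quad t\in(-1,0),\qquad\Sigma_\nu(z)=e^{\frac{\gamma(1-z)}{1+\beta(1-z)}},\quad z\in(-\infty,0).$$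
   Context: For a polynomial $P\not\equiv0$ of degree at most $n$, $[\![P]\!]_n:=\frac1n\sum_{z\in\mathbb{C}:P(z)=0}\delta_z+\frac{n-\deg P}{n}\delta_\infty$ (zeros counted with multiplicity; for nonnegative zeros $\infty$ is identified with $+\infty$). The convention $0^0=1$ is used. For a probability measure $\nu\neq\delta_0$ on $[0,\infty)$ put $\psi_\nu(z)=\int_{[0,\infty)}\frac{uz}{1-uz}\,\nu(\mathrm{d}u)$; on $z\in(-\infty,0)$ this is a strictly increasing bijection onto $(\nu(\{0\})-1,0)$, with inverse $\psi_\nu^{-1}$. The $S$- and $\Sigma$-transforms are $S_\nu(t)=\frac{1+t}{t}\psi_\nu^{-1}(t)$ and $\Sigma_\nu(z)=S_\nu\left(\frac{z}{1-z}\right)=\frac1z\psi_\nu^{-1}\left(\frac{z}{1-z}\right)$. *)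

(* Defs.v *)
From HB Require Import structures.
From mathcomp Require Import all_boot all_order all_algebra.
From mathcomp Require Import complex.
From mathcomp Require Import all_classical all_reals all_analysis.
From mathcomp Require Import measurable_realfun.

Set Implicit Arguments.
Unset Strict Implicit.
Unset Printing Implicit Defensive.

Import Order.TTheory GRing.Theory Num.Theory numFieldNormedType.Exports.

Local Open Scope classical_set_scope.
Local Open Scope ring_scope.

Definition Borel (X : topologicalType) := g_sigma_algebraType (@open X).

Definition weak_cvg (R : realType) (X : ptopologicalType)
    (mu : nat -> {measure set (Borel X) -> \bar R})
    (nu : {measure set (Borel X) -> \bar R}) : Prop :=
  forall f : X -> R, continuous f -> bounded_fun (f : X -> R^o) ->
    (\int[mu n]_(x in [set: Borel X]) f x)%R @[n --> \oo]
      --> (\int[nu]_(x in [set: Borel X]) f x)%R.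

(* The Riemann sphere C \cup {oo}, with oo encoded as None; R[i]^o is C with
   the topology of its absolute value. *)
Definition sphere (R : realType) : ptopologicalType :=
  one_point_compactification (R[i]^o).

Section zero_distribution.
Context {R : realType}.

(* P = lead_coef P *: \prod_(z <- croots P) ('X - z%:P), so that every zero is
   listed as many times as its multiplicity. *)
Definition croots (P : {poly R[i]}) : seq R[i] :=
  sval (closed_field_poly_normal P).

(* [[P]]_n, meant for n > 0, P != 0 and deg P = (size P).-1 <= n. *)
Definition zero_distribution (n : nat) (P : {poly R[i]}) :
    {measure set (Borel (sphere R)) -> \bar R} :=
  measure_add
    (mscale (n%:R^-1 : R)%:nng
       (msum (fun i => \d_(Some (croots P)`_i : Borel (sphere R)))
             (size (croots P))))
    (mscale ((n - (size P).-1)%:R / n%:R : R)%:nng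
       (\d_(None : Borel (sphere R)))).

End zero_distribution.

Section embedding.
Context {R : realType}.

Definition sphere_of_real (x : measurableTypeR R) : Borel (sphere R) :=
  Some (real_complex R x).

Lemma real_complex_continuous : continuous (real_complex R : R -> R[i]^o).
Proof.
move=> x; apply/(@cvgrPdist_lt _ R[i]^o) => e.
rewrite ltcE /= => /andP[/eqP e0 Re0].
have /cvgrPdist_lt/(_ _ Re0) := @cvg_id _ (nbhs x).
apply: filterS => y; rewrite -rmorphB.
by rewrite normc_def /= expr0n addr0 sqrtr_sqr ltcE /= e0 eqxx.
Qed.

Lemma measurable_sphere_of_real : measurable_fun setT sphere_of_real.
Proof.
apply: (@measurability _ _ (measurableTypeR R) (Borel (sphere R)) _ _
  (@open (sphere R)) erefl) => _ [A oA <-].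
rewrite setTI; apply: open_measurable.
have /continuousP : continuous (sphere_of_real : R -> sphere R).
  move=> x; apply: (@cvg_comp _ _ _ (real_complex R) Some).
    exact: real_complex_continuous.
  exact: (@one_point_compactification_some_continuous R[i]^o).
exact.
Qed.

HB.instance Definition _ :=
  isMeasurableFun.Build _ _ _ _ sphere_of_real measurable_sphere_of_real.

End embedding.

Section transforms.
Context {R : realType}.
Implicit Type nu : probability (measurableTypeR R) R.

Definition psi nu (z : R) : R :=
  (\int[nu]_(u in `[0%R, +oo[) (u * z / (1 - u * z)))%R.

(* The z < 0 with psi nu z = t. It is unique when it exists (psi nu is strictly
   increasing on (-oo, 0) when nu is not the Dirac mass at 0); when there is
   none, i.e. for t outside (nu {0} - 1, 0), the value is 0. *)
Definition psi_inv nu (t : R) : R := xget 0 [set z : R | z < 0 /\ psi nu z = t].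

Definition S_transform nu (t : R) : R := (1 + t) / t * psi_inv nu t.

Definition Sigma_transform nu (z : R) : R := S_transform nu (z / (1 - z)).

End transforms.

(* powR satisfies 0 `^ 0 = 1 and 0 `^ c = 0 for c != 0. *)
Definition Ppoly (R : realType) (n : nat) (b c : R) : {poly R} :=
  \poly_(k < n.+1) ((-1) ^+ (n - k) * 'C(n, k)%:R * (`|k%:R + b| `^ c)).

(* Main.v *)
Require Import Defs.
From HB Require Import structures.
From mathcomp Require Import all_boot all_order all_algebra.
From mathcomp Require Import complex.
From mathcomp Require Import all_classical all_reals all_analysis.
From mathcomp Require Import measurable_realfun ring lra zify.

(** With [theta = x d/dx], the polynomial [P_n] is, up to sign,
    [(theta + b)^c (x - 1)^n].  The operator [theta + b] keeps all zeros of a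
    polynomial of degree at most [n] in [[0, +oo[] when [b >= 0] or [b <= - n],
    by an argument in the manner of Gauss and Lucas on the logarithmic
    derivative ([nonneg_roots_euler]).  So the zeros are points [u] of
    [[0, +oo]], which the coordinate [w = 1 / (1 + u)] maps to [[0, 1]], with
    infinity at [w = 0].

    For [s > 0] the mean of [s / (s + u)] over the zeros is
    [- s P_n'(- s) / (n P_n(- s))].  At [- s] all terms of [P_n] have the same
    sign, so this is the mean of [k / n] for the positive weights
    [C(n, k) |k + b|^c s^k].  The ratio of two consecutive weights decreases in
    [k] and, at [k ~ a n], is close to [s / tilt a] with
    [tilt a = a / (1 - a) * exp (- gamma / (a + beta))].  The weights therefore
    decay geometrically on both sides of the [a] with [tilt a = s], and the mean
    tends to this [a] ([scaled_mean_cvg]).  For a limit law [nu] this reads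
    [psi_nu (- 1 / tilt a) = a - 1], which is the formula for the S-transform.

    A law with these means is obtained by compactness: the quantile functions of
    the zeros, in the coordinate [w], are monotone with values in [[0, 1]], hence
    converge pointwise along an ultrafilter, and monotonicity bounds the error of
    their Riemann sums uniformly, so that integrals pass to the limit
    ([limit_quantile]).  Letting [a] tend to [1] shows that no mass escapes to
    infinity ([quantile_gt0]).

    The means of [s / (s + u)] determine the limit, for every choice of the
    sequences, because these functions and the constants span a uniformly dense
    subspace of the continuous functions of [w]: partial fractions show that its
    closure is an algebra, it contains [w] itself (take [s = 1]), and Bernstein
    polynomials do the rest ([kernel_approx_continuous]). *)

Set Implicit Arguments.
Unset Strict Implicit.
Unset Printing Implicit Defensive.

Import Order.TTheory GRing.Theory Num.Theory numFieldNormedType.Exports.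

Local Open Scope classical_set_scope.
Local Open Scope ring_scope.

(** * Polynomials with nonnegative zeros *)

Lemma horner_deriv_prod_XsubC (F : fieldType) (rs : seq F) (x : F) :
  x \notin rs ->
  (\prod_(r <- rs) ('X - r%:P))^`().[x] =
  (\prod_(r <- rs) ('X - r%:P)).[x] * \sum_(r <- rs) (x - r)^-1.
Proof.
elim: rs => [|r rs IH]; first by rewrite !big_nil -polyC1 derivC horner0 mulr0.
rewrite inE negb_or => /andP[xr /IH IHx]; rewrite !big_cons derivM derivXsubC.
rewrite mul1r hornerD !hornerM hornerXsubC IHx.
by field; rewrite subr_eq0.
Qed.

Definition euler (F : nzRingType) (b : F) (p : {poly F}) : {poly F} :=
  'X * p^`() + b *: p.

Section euler_roots.
Variable C : numClosedFieldType.
Implicit Types (b z : C) (p : {poly C}).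

Definition nonneg_roots p := forall z, root p z -> 0 <= z.

(** The imaginary part of [r / (z - r)] is [- r 'Im z / |z - r|^2], which has the
    same sign for all [r >= 0]; a real sum leaves no room for a nonzero [r]. *)
Lemma sum_ratio_real_eq0 (rs : seq C) z : {in rs, forall r, 0 <= r} ->
  z \notin rs -> z \isn't Num.real ->
  \sum_(r <- rs) r / (z - r) \is Num.real -> {in rs, forall r, r = 0}.
Proof.
move=> rs0 zrs zNreal /Creal_ImP; rewrite raddf_sum /=.
have Imterm r : r \in rs -> 'Im (r / (z - r)) = 'Im z * - (r / `|z - r| ^+ 2).
  move=> rrs; have /ger0_real rR := rs0 _ rrs.
  rewrite invC_norm ImMl // ImMl; last first.
    by rewrite realV realX // normr_real.
  by rewrite Im_conj raddfB /= (Creal_ImP r rR) subr0; ring.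
rewrite (eq_big_seq _ Imterm) -big_distrr /= sumrN => /eqP.
rewrite mulf_eq0 oppr_eq0 => /orP[/eqP/Creal_ImP zR|].
  by rewrite zR in zNreal.
rewrite big_seq psumr_eq0 => [/allP all0 r rrs|r rrs]; last first.
  by apply: divr_ge0; [exact: rs0 | exact: exprn_ge0].
have := all0 r rrs; rewrite rrs /= mulf_eq0 invr_eq0 expf_eq0 normr_eq0 /=.
rewrite subr_eq0 => /orP[/eqP //|/eqP zr].
by rewrite zr rrs in zrs.
Qed.

Lemma euler_scale_Xn (a : C) m : euler (- m%:R) (a *: 'X^m) = 0.
Proof.
rewrite /euler derivZ derivXn; case: m => [|m] /=.
  by rewrite mulr0n scaler0 mulr0 oppr0 scale0r addr0.
rewrite -scalerAr mulrnAr -exprS scaleNr scaler_nat.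
by rewrite scalerMnr subrr.
Qed.

(** A zero [z] of [euler b p] outside the zeros [r] of [p] satisfies
    [sum z / (z - r) = - b].  If [z] is not real, imaginary parts force all
    [r = 0].  If [z < 0], each of the [m] terms lies in []0, 1]], so that the sum
    can only be [- b] for [m = 0] or for [m = n] and all terms equal to [1], that
    is, all [r = 0].  In every case [p] is proportional to ['X^m] and [b = - m],
    so that [euler b p = 0]. *)
Lemma nonneg_roots_euler n b p : (size p <= n.+1)%N -> nonneg_roots p ->
  0 <= b \/ b <= - n%:R -> euler b p != 0 -> nonneg_roots (euler b p).
Proof.
move=> szp p0 hb ep0 z.
have [rs defp] := closed_field_poly_normal p.
have pN0 : p != 0.
  by apply: contraNneq ep0 => ->; rewrite /euler deriv0 mulr0 scaler0 addr0.
have lN0 : lead_coef p != 0 by rewrite lead_coef_eq0.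
have rs0 : {in rs, forall r, 0 <= r}.
  by move=> r rrs; apply: p0; rewrite defp rootZ // root_prod_XsubC.
have szrs : (size rs <= n)%N.
  by rewrite -ltnS (leq_trans _ szp) // defp size_scale // size_prod_XsubC.
have [/rs0 //|zrs rz] := boolP (z \in rs).
have [//|zN0] := boolP (0 <= z).
have bR : b \is Num.real.
  case: hb => [/ger0_real //|]; move=> /ler_real; rewrite realN realn.
  by move=> ->.
set m := size rs in szrs.
have key : \sum_(r <- rs) r / (z - r) = - (b + m%:R).
  set q := (\prod_(r <- rs) ('X - r%:P)).[z].
  have qN0 : q != 0 by rewrite /q -rootE root_prod_XsubC.
  have pz : p.[z] = lead_coef p * q by rewrite {1}defp hornerZ.
  have dpz : p^`().[z] = lead_coef p * (q * \sum_(r <- rs) (z - r)^-1).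
    by rewrite {1}defp derivZ hornerZ horner_deriv_prod_XsubC.
  move: rz; rewrite /root /euler hornerD hornerM hornerX hornerZ pz dpz.
  have -> : z * (lead_coef p * (q * \sum_(r <- rs) (z - r)^-1)) +
      b * (lead_coef p * q) =
      lead_coef p * q * (\sum_(r <- rs) z / (z - r) + b).
    by rewrite -big_distrr /=; ring.
  rewrite !mulf_eq0 (negPf lN0) (negPf qN0) /= => /eqP.
  rewrite (eq_big_seq (fun r => 1 + r / (z - r))); last first.
    move=> r rrs; field; rewrite subr_eq0.
    by apply: contraNneq zrs => ->.
  rewrite big_split /= big_const_seq count_predT iter_addr_0 -/m => h.
  by apply/eqP; rewrite -subr_eq0 -[X in _ == X]h; apply/eqP; ring.
(* If all zeros vanish, then [p] is a monomial, which [euler b] kills. *)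
suff all0 : {in rs, forall r, r = 0}.
  have defb : b = - m%:R.
    move: key; rewrite big_seq big1 => [/esym/eqP|r /all0 ->]; last first.
      by rewrite mul0r.
    by rewrite oppr_eq0 addr_eq0 => /eqP.
  case/eqP: ep0; rewrite defp (eq_big_seq (fun=> 'X)); last first.
    by move=> r /all0 ->; rewrite subr0.
  by rewrite big_const_seq count_predT iter_mulr_1 defb euler_scale_Xn.
have [zR|zNR] := boolP (z \is Num.real); last first.
  apply: (sum_ratio_real_eq0 rs0 zrs zNR).
  by rewrite key realN realD // realn.
have z_lt0 : z < 0 by rewrite real_ltNge // real0.
have rz_gt0 r : r \in rs -> 0 < r - z.
  by move=> /rs0 r0; rewrite subr_gt0 (lt_le_trans z_lt0).
have termge0 r : r \in rs -> 0 <= r / (r - z).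
  by move=> rrs; apply: divr_ge0; [exact: rs0 | exact/ltW/rz_gt0].
case: hb => hb.
  have : \sum_(r <- rs) - z / (r - z) = - b.
    rewrite (eq_big_seq (fun r => 1 + r / (z - r))); last first.
      move=> r rrs; have := rz_gt0 r rrs; rewrite lt0r => /andP[h _].
      by field; rewrite h -oppr_eq0 opprB h.
    by rewrite big_split /= big_const_seq count_predT iter_addr_0 -/m key; ring.
  have pos r : r \in rs -> 0 < - z / (r - z).
    by move=> /rz_gt0 ?; apply: divr_gt0; rewrite // oppr_gt0.
  have Nb : - b <= 0 by rewrite oppr_le0.
  move=> sumNb r rrs; suff : - z / (r - z) == 0 by rewrite gt_eqF ?pos.
  move: Nb; rewrite -sumNb => le0.
  have : \sum_(r <- rs) - z / (r - z) == 0.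
    rewrite eq_le le0 big_seq sumr_ge0 // => i irs; exact/ltW/pos.
  rewrite big_seq psumr_eq0 => [/allP /(_ r rrs)|i /pos/ltW //].
  by rewrite rrs.
have : \sum_(r <- rs) r / (r - z) = b + m%:R.
  rewrite -[RHS]opprK -key -sumrN; apply: eq_big_seq => r rrs.
  by rewrite -mulrN -invrN opprB.
move=> sumb.
have : \sum_(r <- rs) r / (r - z) == 0.
  rewrite eq_le big_seq sumr_ge0 // andbT -big_seq sumb.
  rewrite -lerBrDr sub0r (le_trans hb) // lerN2 ler_nat //.
rewrite big_seq psumr_eq0 => [/allP all0 r rrs|i /termge0 //].
have := all0 r rrs; rewrite rrs /= mulf_eq0 invr_eq0.
by rewrite (gt_eqF (rz_gt0 r rrs)) orbF => /eqP.
Qed.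

Definition euler_poly n b c : {poly C} :=
  \poly_(k < n.+1) ((-1) ^+ (n - k) * 'C(n, k)%:R * (k%:R + b) ^+ c).

Lemma coef_euler_poly n b c k : (euler_poly n b c)`_k =
  (-1) ^+ (n - k) * 'C(n, k)%:R * (k%:R + b) ^+ c.
Proof.
rewrite coef_poly; case: ltnP => // nk.
by rewrite bin_small // mulr0 mul0r.
Qed.

Lemma euler_poly0 n b : euler_poly n b 0 = ('X - 1) ^+ n.
Proof.
rewrite /euler_poly poly_def addrC exprDn; apply: eq_bigr => k _.
rewrite expr0 mulr1 -mul_polyC polyCM rmorphXn /= polyCN polyC1 polyC_natr.
by rewrite -mulrA mulr_natl mulrnAr.
Qed.

Lemma euler_polyS n b c : euler b (euler_poly n b c) = euler_poly n b c.+1.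
Proof.
apply/polyP => k; rewrite /euler coefD coefXM coefZ coef_deriv.
case: k => [|k] /=; rewrite !coef_euler_poly exprS; first by ring.
by rewrite -mulr_natr; ring.
Qed.

Lemma euler_poly_neq0 n b c : (0 < n)%N -> euler_poly n b c != 0.
Proof.
move=> n0; have [b0|bN0] := eqVneq b 0.
  apply: contraTneq (oner_neq0 C) => /(congr1 (fun p => p`_n)).
  rewrite coef_euler_poly coef0 subnn binn b0 addr0 !mul1r => /eqP.
  by rewrite expf_eq0 pnatr_eq0 (gtn_eqF n0) andbF.
apply: contraTneq (oner_neq0 C) => /(congr1 (fun p => p`_0)).
rewrite coef_euler_poly coef0 bin0 mulr1 add0r => /eqP.
by rewrite mulf_eq0 !expf_eq0 oppr_eq0 oner_eq0 (negPf bN0) !andbF.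
Qed.

Lemma nonneg_roots_euler_poly n b c : (0 < n)%N -> 0 <= b \/ b <= - n%:R ->
  nonneg_roots (euler_poly n b c).
Proof.
move=> n0 hb; elim: c => [|c IH].
  move=> z; rewrite euler_poly0 -polyC1 /root horner_exp hornerXsubC expf_eq0.
  by rewrite subr_eq0 => /andP[_ /eqP ->]; exact: ler01.
rewrite -euler_polyS; apply: (@nonneg_roots_euler n) => //.
  exact: size_poly.
by rewrite euler_polyS euler_poly_neq0.
Qed.

End euler_roots.

(** * Concentration of the weights [C(n, k) |k + b|^c s^k] *)

Section weights.
Variable R : realType.
Implicit Types (b s beta gamma a : R) (n c k : nat).

(** Past [k1] the weights are dominated by a geometric sequence of ratio [rho],
    whose mean excess over [k1] is at most [rho / (1 - rho)]. *)
Lemma mean_le_geometric (w : nat -> R) (rho : R) n k1 : (forall k, 0 <= w k) ->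
  0 <= rho < 1 ->
  (forall k, (k1 <= k < n)%N -> w k.+1 <= rho * w k) ->
  \sum_(k < n.+1) k%:R * w k <=
    (k1%:R + rho / (1 - rho)) * \sum_(k < n.+1) w k.
Proof.
move=> w0 /andP[rho0 rho1] ratio.
set W := \sum_(k < n.+1) w k; have rho1' : 0 < 1 - rho by rewrite subr_gt0.
pose T := \sum_(k < n.+1) (k - k1)%N%:R * w k.
have meanT : \sum_(k < n.+1) k%:R * w k <= k1%:R * W + T.
  rewrite /T /W big_distrr -big_split /=; apply: ler_sum => k _.
  by rewrite -mulrDl ler_wpM2r // -natrD ler_nat; lia.
(* Shifting the index by one turns the ratio bound into an inequality for [T]. *)
suff Tle : T <= rho / (1 - rho) * W by rewrite (le_trans meanT) // mulrDl lerD2l.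
have : T <= rho * (T + W).
  rewrite {1}/T big_ord_recl mul0r add0r.
  apply: (@le_trans _ _ (\sum_(k < n) rho * (((k - k1)%N%:R + 1) * w k))).
    apply: ler_sum => k _ /=; rewrite /bump leq0n add1n.
    have [kk1|kk1] := ltnP k k1.
      have -> : (k.+1 - k1 = 0)%N by lia.
      by rewrite mul0r !mulr_ge0 // addr_ge0.
    rewrite subSn // -natr1 mulrCA ler_wpM2l ?addr_ge0 //.
    by apply: ratio; rewrite kk1 ltn_ord.
  rewrite -big_distrr ler_wpM2l //= /T /W -big_split /=.
  rewrite [leRHS]big_ord_recr /=; apply: ler_wpDr.
    by rewrite addr_ge0 // mulr_ge0.
  by apply: ler_sum => k _; rewrite mulrDl mul1r.
by move=> h; rewrite -mulrA (mulrC _^-1) mulrA ler_pdivlMr //; lra.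
Qed.

Definition weight n b c s k : R := 'C(n, k)%:R * `|k%:R + b| ^+ c * s ^+ k.

Definition scaled_mean n b c s : R :=
  (\sum_(k < n.+1) k%:R * weight n b c s k) /
  (n%:R * \sum_(k < n.+1) weight n b c s k).

Lemma weight_ge0 n b c s k : 0 <= s -> 0 <= weight n b c s k.
Proof. by move=> s0; rewrite /weight !mulr_ge0 // exprn_ge0. Qed.

Lemma sum_weight_gt0 n b c s : (0 < n)%N -> 0 < s ->
  0 < \sum_(k < n.+1) weight n b c s k.
Proof.
move=> n0 s0; have w0 k : 0 <= weight n b c s k by rewrite weight_ge0 // ltW.
rewrite lt0r sumr_ge0 // andbT psumr_neq0 //.
have [b0|bN0] := eqVneq b 0; apply/hasP.
  exists ord_max; rewrite ?mem_index_enum //= /weight b0 addr0 binn mul1r.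
  by rewrite normr_nat mulr_gt0 // exprn_gt0 // ltr0n.
exists ord0; rewrite ?mem_index_enum //= /weight add0r bin0 mul1r expr0 mulr1.
by rewrite exprn_gt0 // normr_gt0.
Qed.

(** Bounding [(1 + 1 / (k + b)) ^+ c] by an exponential gives a ratio bound that
    is decreasing in [k] on either branch of the condition on [b], and whose
    limit for [k ~ a n] is explicit. *)
Lemma weight_step n b c s k : 0 < s -> 0 <= b \/ b <= - n%:R -> (0 < k < n)%N ->
  weight n b c s k.+1 <=
  (n - k)%N%:R / k.+1%:R * expR (c%:R / (k%:R + b)) * s * weight n b c s k.
Proof.
move=> s0 hb /andP[k0 kn].
have kR : 0 < k%:R :> R by rewrite ltr0n.
have knR : k%:R + 1 <= n%:R :> R by rewrite natr1 ler_nat.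
have kbN0 : k%:R + b != 0.
  by case: hb => hb; apply/negP => /eqP; lra.
have kb1 : 0 <= 1 + (k%:R + b)^-1.
  case: hb => hb; first by rewrite addr_ge0 // invr_ge0; lra.
  have kb : k%:R + b <= -1 by lra.
  rewrite -(opprK (_ + b)) invrN subr_ge0 invf_le1; lra.
have -> : weight n b c s k.+1 = (n - k)%N%:R / k.+1%:R * s *
    (1 + (k%:R + b)^-1) ^+ c * weight n b c s k.
  rewrite /weight; have -> : 'C(n, k.+1)%:R = (n - k)%N%:R / k.+1%:R * 'C(n, k)%:R :> R.
    rewrite mulrAC -natrM -mul_bin_left natrM.
    by rewrite (mulrC k.+1%:R) mulfK // pnatr_eq0.
  have -> : k.+1%:R + b = (1 + (k%:R + b)^-1) * (k%:R + b) :> R.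
    by rewrite -natr1; field.
  by rewrite normrM (ger0_norm kb1) exprMn exprS; ring.
apply: ler_wpM2r; first by rewrite weight_ge0 // ltW.
rewrite [leRHS]mulrAC; apply: ler_wpM2l; first by rewrite !mulr_ge0 // ltW.
rewrite expRM_natl lerXn2r ?nnegrE ?expR_ge0 //.
exact: expR_ge1Dx.
Qed.

Lemma weight_reflect n b c s k : 0 < s -> (k <= n)%N ->
  weight n (- n%:R - b) c s^-1 k * s ^+ n = weight n b c s (n - k).
Proof.
move=> s0 kn; rewrite /weight bin_sub // natrB // -(subnK kn) exprD subnK //.
have -> : k%:R + (- n%:R - b) = - (n%:R - k%:R + b) by ring.
rewrite normrN exprVn; field; exact/lt0r_neq0/exprn_gt0.
Qed.

(** The symmetry [k -> n - k] exchanges the two branches of the condition on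
    [b]; it turns upper bounds on the mean into lower bounds. *)
Lemma scaled_mean_reflect n b c s : (0 < n)%N -> 0 < s ->
  scaled_mean n (- n%:R - b) c s^-1 = 1 - scaled_mean n b c s.
Proof.
move=> n0 s0; have W0 := sum_weight_gt0 b c n0 s0.
have sn0 : s ^+ n != 0 by exact/lt0r_neq0/exprn_gt0.
have total : (\sum_(k < n.+1) weight n (- n%:R - b) c s^-1 k) * s ^+ n =
    \sum_(k < n.+1) weight n b c s k.
  rewrite big_distrl [RHS](reindex_inj rev_ord_inj) /=.
  by apply: eq_bigr => k _; rewrite subSS weight_reflect // -ltnS.
have mean : (\sum_(k < n.+1) k%:R * weight n (- n%:R - b) c s^-1 k) * s ^+ n =
    n%:R * (\sum_(k < n.+1) weight n b c s k) -
    \sum_(k < n.+1) k%:R * weight n b c s k.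
  rewrite big_distrl (reindex_inj rev_ord_inj) big_distrr -sumrB /=.
  apply: eq_bigr => k _; have kn : (k <= n)%N by rewrite -ltnS.
  rewrite subSS -mulrA weight_reflect ?leq_subr // subKn // natrB //; ring.
have nN0 : n%:R != 0 :> R by rewrite pnatr_eq0 -lt0n.
rewrite /scaled_mean -(mulfK sn0 (\sum_(k < _) _ * _)) mean.
rewrite -(mulfK sn0 (\sum_(k < _) weight _ _ _ _^-1 _)) total.
by field; rewrite nN0 sn0 (lt0r_neq0 W0).
Qed.

(** The value of [s] for which the ratio of consecutive weights at [k ~ a n]
    tends to [1], in the limit [b ~ beta n], [c ~ gamma n]. *)
Definition tilt beta gamma a : R := a / (1 - a) * expR (- (gamma / (a + beta))).

Lemma tilt_reflect beta gamma a : 0 < a < 1 ->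
  tilt (- 1 - beta) gamma (1 - a) = (tilt beta gamma a)^-1.
Proof.
move=> /andP[a0 a1]; rewrite /tilt invfM -expRN opprK invf_div.
have -> : 1 - a + (- 1 - beta) = - (a + beta) by ring.
by rewrite invrN mulrN opprK; congr (_ / _ * _); ring.
Qed.

(** At [k ~ a n] the weights already decrease at a rate below [1], and this rate
    only improves for larger [k]: apply [mean_le_geometric] there. *)
Lemma scaled_mean_limsup beta gamma s a (b : nat -> R) (c : nat -> nat) eps :
  0 < s -> (forall n, 0 <= b n \/ b n <= - n%:R) ->
  beta \notin `](-1), 0[ ->
  b n / n%:R @[n --> \oo] --> beta ->
  (c n)%:R / n%:R @[n --> \oo] --> gamma ->
  0 < a < 1 -> s < tilt beta gamma a -> 0 < eps ->
  \forall n \near \oo, scaled_mean n (b n) (c n) s <= a + eps.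
Proof.
move=> s0 hb hbeta cvgb cvgc /andP[a0 a1] stilt eps0.
have abN0 : a + beta != 0.
  apply/negP => /eqP ab; move: hbeta; rewrite in_itv /= => /negP; apply.
  by apply/andP; split; lra.
pose k n := (Num.truncn (a * n%:R)).+1.
have kP n : a * n%:R < (k n)%:R <= a * n%:R + 1.
  have : 0 <= a * n%:R by rewrite mulr_ge0 // ltW.
  by move=> /truncn_itv /andP[h1 h2]; rewrite /k h2 -natr1 lerD2r.
have limV : (n%:R^-1 : R) @[n --> \oo] --> 0.
  by rewrite -(cvg_shiftS (fun n => n%:R^-1 : R)); exact: cvg_harmonic.
have cvgk : (k n)%:R / n%:R @[n --> \oo] --> a.
  apply: (@squeeze_cvgr _ _ _ _ (fun=> a) (fun n => a + n%:R^-1)).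
  - near=> n; have n0 : 0 < n%:R :> R by rewrite ltr0n; near: n; exists 1%N.
    rewrite ler_pdivlMr // ler_pdivrMr // mulrDl mulVf ?gt_eqF //.
    by have /andP[/ltW -> ->] := kP n.
  - exact: cvg_cst.
  - by rewrite -[X in _ --> X]addr0; apply: cvgD => //; exact: cvg_cst.
pose B n := (1 - (k n)%:R / n%:R) / ((k n)%:R / n%:R + n%:R^-1) *
  expR ((c n)%:R / n%:R / ((k n)%:R / n%:R + b n / n%:R)) * s.
have limB : B n @[n --> \oo] --> s / tilt beta gamma a.
  have -> : s / tilt beta gamma a = (1 - a) / (a + 0) * expR (gamma / (a + beta)) * s.
    by rewrite /tilt invfM invf_div -expRN opprK addr0; ring.
  apply: cvgM; last exact: cvg_cst.
  apply: cvgM.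
    apply: cvgM; first by apply: cvgB => //; exact: cvg_cst.
    by apply: cvgV; [rewrite addr0 gt_eqF | exact: cvgD].
  apply: continuous_cvg; first exact: continuous_expR.
  apply: cvgM => //; apply: cvgV => //; exact: cvgD.
have tilt0 : 0 < tilt beta gamma a := lt_trans s0 stilt.
pose rho := (1 + s / tilt beta gamma a) / 2.
have lim_lt1 : s / tilt beta gamma a < 1 by rewrite ltr_pdivrMr // mul1r.
have lim_gt0 : 0 < s / tilt beta gamma a by rewrite divr_gt0.
have rho01 : 0 <= rho < 1 by rewrite /rho; apply/andP; split; lra.
near=> n.
have n0 : (0 < n)%N by near: n; exists 1%N.
have nR : 0 < n%:R :> R by rewrite ltr0n.
have Brho : B n <= rho.
  near: n; apply: (cvgr_le _ limB); rewrite /rho; lra.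
(* Beyond [k n] both factors of the bound of [weight_step] decrease. *)
have rate j : (k n <= j < n)%N -> weight n (b n) (c n) s j.+1 <=
    rho * weight n (b n) (c n) s j.
  move=> /andP[kj jn]; have j0 : (0 < j)%N by exact: leq_trans kj.
  apply: (le_trans (weight_step _ _ (hb n) _)) => //; first by rewrite j0.
  apply: ler_wpM2r; first by rewrite weight_ge0 // ltW.
  apply: le_trans Brho.
  have -> : B n = (n%:R - (k n)%:R) / ((k n)%:R + 1) *
      expR ((c n)%:R / ((k n)%:R + b n)) * s.
    rewrite /B; congr (_ * expR _ * _).
      by field; rewrite (lt0r_neq0 nR) natr1 pnatr_eq0.
    by rewrite -mulrDl invfM invrK mulrACA mulVf ?mulr1 // lt0r_neq0.
  apply: ler_wpM2r; first exact: ltW.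
  have kjR : (k n)%:R <= j%:R :> R by rewrite ler_nat.
  have jnR : j%:R + 1 <= n%:R :> R by rewrite natr1 ler_nat.
  have k1R : 1 <= (k n)%:R :> R by rewrite ler1n.
  apply: ler_pM; rewrite ?divr_ge0 ?expR_ge0 //.
    rewrite natrB ?(ltnW jn) // -natr1; apply: ler_pM; rewrite ?invr_ge0; try lra.
    by rewrite lef_pV2 ?posrE; lra.
  rewrite ler_expR; apply: ler_wpM2l => //.
  case: (hb n) => hbn; first by rewrite lef_pV2 ?posrE; lra.
  by rewrite lef_nV2 ?negrE; lra.
have W0 := sum_weight_gt0 (b n) (c n) n0 s0.
rewrite /scaled_mean ler_pdivrMr ?mulr_gt0 //.
apply: (le_trans (mean_le_geometric _ rho01 rate)).
  by move=> j; rewrite weight_ge0 // ltW.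
rewrite mulrA; apply: ler_wpM2r; first exact: ltW.
have /andP[_ kle] := kP n.
have : 1 + rho / (1 - rho) <= eps * n%:R.
  rewrite -ler_pdivrMl // mulrC ltW //; near: n; exact: nbhs_infty_gtr.
by lra.
Unshelve. all: by end_near.
Qed.

End weights.

Section tilt.
Variable R : realType.
Implicit Types (b s beta gamma a : R) (n c k : nat).

Lemma tilt_gt0 beta gamma a : 0 < a < 1 -> 0 < tilt beta gamma a.
Proof.
by move=> /andP[a0 a1]; rewrite mulr_gt0 ?expR_gt0 // divr_gt0 // subr_gt0.
Qed.

Lemma tilt_pole beta a : beta \notin `](-1), 0[ -> 0 < a < 1 ->
  0 <= beta /\ 0 < a + beta \/ beta <= -1 /\ a + beta < 0.
Proof.
rewrite in_itv /= negb_and -!leNgt => /orP[hb|hb] /andP[a0 a1]; [right|left];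
  split => //; lra.
Qed.

Lemma tilt_lt beta gamma a a' : beta \notin `](-1), 0[ -> 0 <= gamma ->
  0 < a -> a < a' -> a' < 1 -> tilt beta gamma a < tilt beta gamma a'.
Proof.
move=> hbeta g0 a0 aa' a'1.
have a01 : 0 < a < 1 by apply/andP; split; lra.
have a'01 : 0 < a' < 1 by apply/andP; split; lra.
have a'0 : 0 < a' by lra.
apply: (@lt_le_trans _ _ (a' / (1 - a') * expR (- (gamma / (a + beta))))).
  rewrite ltr_pM2r ?expR_gt0 // ltr_pM // ?invr_ge0; try lra.
  by rewrite ltf_pV2 ?posrE; lra.
apply: ler_wpM2l; first by rewrite divr_ge0; lra.
rewrite ler_expR lerN2; apply: ler_wpM2l => //.
case: (tilt_pole hbeta a01) => -[hb ab].
  by rewrite lef_pV2 ?posrE; lra.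
case: (tilt_pole hbeta a'01) => -[hb' ab']; first lra.
by rewrite lef_nV2 ?negrE; lra.
Qed.

Lemma tilt_continuous beta gamma a : beta \notin `](-1), 0[ -> 0 < a < 1 ->
  {for a, continuous (tilt beta gamma)}.
Proof.
move=> hbeta a01; have /andP[a0 a1] := a01.
apply: cvgM.
  apply: cvgM => //; apply: cvgV; first by rewrite subr_eq0 gt_eqF.
  by apply: cvgB => //; exact: cvg_cst.
apply: continuous_cvg; first exact: continuous_expR.
apply: cvgN; apply: cvgM; first exact: cvg_cst.
apply: cvgV; last by apply: cvgD => //; exact: cvg_cst.
by case: (tilt_pole hbeta a01) => -[_ ab]; rewrite ?(gt_eqF ab) ?(lt_eqF ab).
Qed.

(** Near [a = 0] the exponential factor is bounded: for [beta >= 0] its exponent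
    is negative, and for [beta <= -1] the pole [- beta] is at distance at least
    [1 / 2] from [a <= 1 / 2]. *)
Lemma tilt_small beta gamma s : beta \notin `](-1), 0[ -> 0 <= gamma -> 0 < s ->
  exists2 a, 0 < a < 1 & tilt beta gamma a <= s.
Proof.
move=> hbeta g0 s0; pose e := expR (2 * gamma); have e0 : 0 < e := expR_gt0 _.
pose a := Num.min 2^-1 (s / (2 * e)).
have a0 : 0 < a by rewrite lt_min divr_gt0 ?mulr_gt0 // andbT.
have a2 : a <= 2^-1 by rewrite ge_min lexx.
have a01 : 0 < a < 1 by apply/andP; split; lra.
exists a => //; apply: (@le_trans _ _ ((2 * a) * e)); last first.
  rewrite mulrAC mulrC -ler_pdivlMr ?mulr_gt0 //.
  by rewrite ge_min lexx orbT.
apply: ler_pM; rewrite ?expR_ge0 //; first by rewrite divr_ge0; lra.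
  rewrite ler_pdivrMr; last lra.
  by rewrite mulrAC -[leLHS]mul1r ler_wpM2r; lra.
rewrite ler_expR -mulrN -(mulrC gamma); apply: ler_wpM2l => //.
case: (tilt_pole hbeta a01) => -[hb ab].
  by apply: (@le_trans _ _ 0) => //; rewrite oppr_le0 invr_ge0 ltW.
rewrite -invrN -[leRHS]invrK lef_pV2 ?posrE; lra.
Qed.

(** The behaviour near [a = 1] follows from that near [a = 0] by [tilt_reflect];
    the intermediate value theorem gives the rest. *)
Lemma tilt_surj beta gamma s : beta \notin `](-1), 0[ -> 0 <= gamma -> 0 < s ->
  exists2 a, 0 < a < 1 & tilt beta gamma a = s.
Proof.
move=> hbeta g0 s0.
have [a1 a1P a1s] := tilt_small hbeta g0 s0.
have hbeta' : - 1 - beta \notin `](-1), 0[.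
  by move: hbeta; rewrite !in_itv /=; apply: contra => /andP[? ?];
    apply/andP; split; lra.
have s'0 : 0 < s^-1 by rewrite invr_gt0.
have [a a01 a2s] := tilt_small hbeta' g0 s'0.
pose a2 := 1 - a; have a2P : 0 < a2 < 1.
  by case/andP: a01 => ? ?; rewrite /a2; apply/andP; split; lra.
have a2s' : s <= tilt beta gamma a2.
  move: a2s; rewrite -[a](subKr 1) -/a2 tilt_reflect //.
  by rewrite lef_pV2 ?posrE // tilt_gt0.
case/andP: a1P => a10 a11; case/andP: a2P => a20 a21.
have a12 : a1 <= a2.
  rewrite leNgt; apply/negP => /(tilt_lt hbeta g0 a20) /(_ a11); lra.
have [||x] := @IVT R (tilt beta gamma) a1 a2 s a12.
- by apply: continuous_in_subspaceT => x; rewrite inE /= in_itv /= => /andP[? ?];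
    apply: tilt_continuous => //; apply/andP; split; lra.
- by rewrite ge_min a1s le_max a2s' orbT.
- by rewrite in_itv /= => /andP[? ?] <-; exists x => //; apply/andP; split; lra.
Qed.

Lemma scaled_mean_cvg beta gamma a (b : nat -> R) (c : nat -> nat) :
  (forall n, 0 <= b n \/ b n <= - n%:R) ->
  beta \notin `](-1), 0[ -> 0 <= gamma ->
  b n / n%:R @[n --> \oo] --> beta ->
  (c n)%:R / n%:R @[n --> \oo] --> gamma ->
  0 < a < 1 ->
  scaled_mean n (b n) (c n) (tilt beta gamma a) @[n --> \oo] --> a.
Proof.
move=> hb hbeta g0 cvgb cvgc a01.
(* The upper half of the claim; the lower half is its reflection. *)
have half beta' (b' : nat -> R) a' eps : (forall n, 0 <= b' n \/ b' n <= - n%:R) ->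
    beta' \notin `](-1), 0[ -> b' n / n%:R @[n --> \oo] --> beta' ->
    0 < a' < 1 -> 0 < eps ->
    \forall n \near \oo,
      scaled_mean n (b' n) (c n) (tilt beta' gamma a') <= a' + eps.
  move=> hb' hbeta' cvgb' a'01 eps0; have /andP[a'0 a'1] := a'01.
  pose d := Num.min (eps / 2) ((1 - a') / 2).
  have d0 : 0 < d by rewrite lt_min; apply/andP; split; lra.
  have de : d <= eps / 2 by rewrite ge_min lexx.
  have d1 : d <= (1 - a') / 2 by rewrite ge_min lexx orbT.
  have := @scaled_mean_limsup _ beta' gamma (tilt beta' gamma a') (a' + d) b' c
    (eps / 2) (tilt_gt0 _ _ a'01) hb' hbeta' cvgb' cvgc _ _ _.
  have h1 : 0 < a' + d < 1 by apply/andP; split; lra.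
  have h2 : tilt beta' gamma a' < tilt beta' gamma (a' + d) by apply: tilt_lt => //; lra.
  have h3 : 0 < eps / 2 by lra.
  move=> /(_ h1 h2 h3); apply: filterS => n /le_trans; apply; lra.
apply/cvgrPdist_le => eps eps0.
have a'01 : 0 < 1 - a < 1 by case/andP: a01 => ? ?; apply/andP; split; lra.
near=> n.
have n0 : (0 < n)%N by near: n; exists 1%N.
have up : scaled_mean n (b n) (c n) (tilt beta gamma a) <= a + eps.
  by near: n; exact: half.
have down : scaled_mean n (- n%:R - b n) (c n)
    (tilt (- 1 - beta) gamma (1 - a)) <= 1 - a + eps.
  near: n; apply: (half _ (fun n => - n%:R - b n)) => //.
  - by move=> n; case: (hb n) => ?; [right|left]; lra.
  - by move: hbeta; rewrite !in_itv /=; apply: contra => /andP[? ?];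
      apply/andP; split; lra.
  - apply: cvg_trans (cvgB (cvg_cst (-1 : R)) cvgb).
    apply: near_eq_cvg; near=> n; have n0 : n%:R != 0 :> R.
      by rewrite pnatr_eq0 -lt0n; near: n; exists 1%N.
    by rewrite /= mulrBl mulNr divff.
rewrite tilt_reflect // scaled_mean_reflect // ?tilt_gt0 // in down.
by rewrite ler_norml; apply/andP; split; lra.
Unshelve. all: by end_near.
Qed.

End tilt.

(** * Density of the Stieltjes kernels on the unit interval *)

Section stieltjes_kernels.
Variable R : realType.
Implicit Types (s t w : R) (g : R -> R).

(** The function [s / (s + u)] of [u] in the coordinate [w = 1 / (1 + u)]; it
    extends to [u = +oo], that is [w = 0], by the value [0]. *)
Definition stieltjes_kernel s w : R := s * w / (s * w + (1 - w)).

Definition kernel_comb (a : R) (l : seq (R * R)) w : R :=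
  a + \sum_(x <- l) x.1 * stieltjes_kernel x.2 w.

Definition kernel_approx g := forall eps, 0 < eps -> exists a l,
  all (fun x => 0 < x.2) l /\
  {in `[0, 1], forall w, `|g w - kernel_comb a l w| <= eps}.

Lemma kernel_den_gt0 s w : 0 < s -> w \in `[0, 1] -> 0 < s * w + (1 - w).
Proof.
rewrite in_itv /= => s0 /andP[w0 w1]; move: w0; rewrite le_eqVlt.
move=> /orP[/eqP <-|w0]; first by rewrite mulr0; lra.
have : 0 < s * w by rewrite mulr_gt0.
lra.
Qed.

Lemma kernel_itv s w : 0 < s -> w \in `[0, 1] -> 0 <= stieltjes_kernel s w <= 1.
Proof.
move=> s0 w01; have D0 := kernel_den_gt0 s0 w01.
move: w01; rewrite in_itv /= => /andP[w0 w1].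
have sw0 : 0 <= s * w by rewrite mulr_ge0 // ltW.
by rewrite divr_ge0 ?(ltW D0) //= ler_pdivrMr // mul1r; lra.
Qed.

Lemma kernel_comb_bound a l : all (fun x => 0 < x.2) l ->
  {in `[0, 1], forall w, `|kernel_comb a l w| <= `|a| + \sum_(x <- l) `|x.1|}.
Proof.
move=> lpos w w01; rewrite (le_trans (ler_normD _ _)) // lerD2l.
rewrite (le_trans (ler_norm_sum _ _ _)) // !big_seq; apply: ler_sum => x xl.
have /andP[k0 k1] := kernel_itv (allP lpos x xl) w01.
by rewrite normrM -[leRHS]mulr1 ler_wpM2l // ger0_norm.
Qed.

Lemma kernel_approx_bounded g : kernel_approx g ->
  exists2 M, 0 < M & {in `[0, 1], forall w, `|g w| <= M}.
Proof.
move=> /(_ 1 ltr01)[a [l [lpos gl]]].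
exists (1 + (`|a| + \sum_(x <- l) `|x.1|)).
  by rewrite ltr_pwDl // addr_ge0 // sumr_ge0.
move=> w w01; rewrite -[g w](subrK (kernel_comb a l w)).
rewrite (le_trans (ler_normD _ _)) // lerD ?gl //.
exact: kernel_comb_bound.
Qed.

Lemma kernel_approx_comb a l : all (fun x => 0 < x.2) l ->
  kernel_approx (kernel_comb a l).
Proof. by move=> lpos e e0; exists a, l; split => // w _; rewrite subrr normr0 ltW. Qed.

Lemma kernel_approx_lim g :
  (forall eps, 0 < eps -> exists2 g', kernel_approx g' &
    {in `[0, 1], forall w, `|g w - g' w| <= eps}) -> kernel_approx g.
Proof.
move=> gapprox eps eps0; have eps20 : 0 < eps / 2 by lra.
have [g' /(_ _ eps20)[a [l [lpos gl]]] gg'] := gapprox _ eps20.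
exists a, l; split => // w w01.
have -> : g w - kernel_comb a l w = g w - g' w + (g' w - kernel_comb a l w) by ring.
rewrite (le_trans (ler_normD _ _)) // (splitr eps) lerD //; [exact: gg'|exact: gl].
Qed.

Lemma kernel_approx_ext g g' : {in `[0, 1], g =1 g'} ->
  kernel_approx g -> kernel_approx g'.
Proof.
move=> gg' ga; apply: kernel_approx_lim => eps eps0; exists g => // w w01.
by rewrite gg' // subrr normr0 ltW.
Qed.

Lemma kernel_approx_cst a : kernel_approx (fun=> a).
Proof.
apply: (@kernel_approx_ext (kernel_comb a [::])); last exact: kernel_approx_comb.
by move=> w _; rewrite /kernel_comb big_nil addr0.
Qed.

Lemma kernel_approx_kernel s : 0 < s -> kernel_approx (stieltjes_kernel s).
Proof.
move=> s0; apply: (@kernel_approx_ext (kernel_comb 0 [:: (1, s)])).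
  by move=> w _; rewrite /kernel_comb big_seq1 add0r mul1r.
by apply: kernel_approx_comb; rewrite /= s0.
Qed.

Lemma kernel_approxD g g' : kernel_approx g -> kernel_approx g' ->
  kernel_approx (fun w => g w + g' w).
Proof.
move=> ga ga' eps eps0; have eps20 : 0 < eps / 2 by lra.
have [a [l [lpos gl]]] := ga _ eps20.
have [a' [l' [lpos' gl']]] := ga' _ eps20.
exists (a + a'), (l ++ l'); rewrite all_cat lpos lpos'; split => // w w01.
have -> : g w + g' w - kernel_comb (a + a') (l ++ l') w =
    (g w - kernel_comb a l w) + (g' w - kernel_comb a' l' w).
  by rewrite /kernel_comb big_cat /=; ring.
rewrite (le_trans (ler_normD _ _)) // (splitr eps) lerD //; [exact: gl|exact: gl'].
Qed.

Lemma kernel_approxZ k g : kernel_approx g -> kernel_approx (fun w => k * g w).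
Proof.
move=> ga eps eps0; have k0 : 0 < `|k| + 1 by rewrite ltr_wpDl.
have e0 : 0 < eps / (`|k| + 1) by rewrite divr_gt0.
have [a [l [lpos gl]]] := ga _ e0.
exists (k * a), [seq (k * x.1, x.2) | x <- l]; split.
  by rewrite all_map; apply: sub_all lpos.
move=> w w01; have -> : k * g w - kernel_comb (k * a) [seq (k * x.1, x.2) | x <- l] w =
    k * (g w - kernel_comb a l w).
  rewrite /kernel_comb big_map mulrBr mulrDr big_distrr /=.
  by under eq_bigr do rewrite -mulrA.
rewrite normrM; apply: (@le_trans _ _ ((`|k| + 1) * (eps / (`|k| + 1)))).
  by apply: ler_pM => //; [rewrite lerDl | exact: gl].
by rewrite mulrC divfK // gt_eqF.
Qed.

(** Partial fractions in the variable [u]. *)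
Lemma kernel_mulE s t w : 0 < s -> 0 < t -> s != t -> w \in `[0, 1] ->
  stieltjes_kernel s w * stieltjes_kernel t w =
  t / (t - s) * stieltjes_kernel s w + - (s / (t - s)) * stieltjes_kernel t w.
Proof.
move=> s0 t0 st w01.
have /lt0r_neq0 Ds := kernel_den_gt0 s0 w01.
have /lt0r_neq0 Dt := kernel_den_gt0 t0 w01.
rewrite /stieltjes_kernel; field.
by rewrite Ds Dt subr_eq0 eq_sym st.
Qed.

Lemma kernel_lipschitz s t w : 0 < s -> 0 < t -> w \in `[0, 1] ->
  `|stieltjes_kernel s w - stieltjes_kernel t w| <= `|s - t| / s.
Proof.
move=> s0 t0 w01.
have Ds := kernel_den_gt0 s0 w01.
have Dt := kernel_den_gt0 t0 w01.
have -> : stieltjes_kernel s w - stieltjes_kernel t w =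
    (s - t) / s * (stieltjes_kernel s w * ((1 - w) / (t * w + (1 - w)))).
  rewrite /stieltjes_kernel; field.
  by rewrite !lt0r_neq0.
have /andP[k0 k1] := kernel_itv s0 w01.
move: (w01); rewrite in_itv /= => /andP[w0 w1].
have tw0 : 0 <= t * w by rewrite mulr_ge0 // ltW.
have /andP[q0 q1] : 0 <= (1 - w) / (t * w + (1 - w)) <= 1.
  rewrite ler_pdivrMr // mul1r lerDr tw0 andbT.
  by apply: divr_ge0; [lra | exact: ltW].
rewrite normrM normf_div (gtr0_norm s0) -[leRHS]mulr1 ler_wpM2l //.
  by rewrite divr_ge0 // ltW.
by rewrite ger0_norm; [exact: mulr_ile1 | exact: mulr_ge0].
Qed.

(** For [s = t] partial fractions degenerate; the square is the uniform limit of
    products of kernels with distinct parameters. *)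
Lemma kernel_approx_mul_kernel s t : 0 < s -> 0 < t ->
  kernel_approx (fun w => stieltjes_kernel s w * stieltjes_kernel t w).
Proof.
have distinct t' s' : 0 < s' -> 0 < t' -> s' != t' ->
    kernel_approx (fun w => stieltjes_kernel s' w * stieltjes_kernel t' w).
  move=> s0 t0 st.
  apply: (@kernel_approx_ext (fun w => t' / (t' - s') * stieltjes_kernel s' w +
      - (s' / (t' - s')) * stieltjes_kernel t' w)).
    by move=> w w01; rewrite kernel_mulE.
  by apply: kernel_approxD; apply: kernel_approxZ; exact: kernel_approx_kernel.
move=> s0 t0; have [<-|st] := eqVneq s t; last exact: distinct.
apply: kernel_approx_lim => eps eps0; have se0 : 0 < s * eps by rewrite mulr_gt0.
exists (fun w => stieltjes_kernel s w * stieltjes_kernel (s + s * eps) w).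
  apply: distinct => //; first lra.
  by rewrite -subr_eq0 opprD addNKr oppr_eq0 gt_eqF.
move=> w w01; rewrite -mulrBr normrM.
have /andP[k0 k1] := kernel_itv s0 w01.
rewrite -[leRHS]mul1r; apply: ler_pM => //; first by rewrite ger0_norm.
apply: le_trans (kernel_lipschitz s0 _ w01) _; first lra.
rewrite opprD addNKr normrN ger0_norm; last exact: ltW.
by rewrite mulrAC divff ?mul1r // gt_eqF.
Qed.

Lemma kernel_approx_sum (I : Type) (l : seq I) (G : I -> R -> R) (P : pred I) :
  all P l -> (forall i, P i -> kernel_approx (G i)) ->
  kernel_approx (fun w => \sum_(i <- l) G i w).
Proof.
move=> + GP; elim: l => [_|i l IH /= /andP[Pi /IH al]].
  by apply: kernel_approx_ext (kernel_approx_cst 0) => w _; rewrite big_nil.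
apply: kernel_approx_ext (kernel_approxD (GP _ Pi) al) => w _.
by rewrite big_cons.
Qed.

Lemma kernel_approxM g g' : kernel_approx g -> kernel_approx g' ->
  kernel_approx (fun w => g w * g' w).
Proof.
have step h : (forall a l, all (fun x => 0 < x.2) l ->
    kernel_approx (fun w => kernel_comb a l w * h w)) -> kernel_approx h ->
    forall k, kernel_approx k -> kernel_approx (fun w => k w * h w).
  move=> comb ha k ka; apply: kernel_approx_lim => eps eps0.
  have [M M0 hM] := kernel_approx_bounded ha.
  have [a [l [lpos kl]]] := ka _ (divr_gt0 eps0 M0).
  exists (fun w => kernel_comb a l w * h w); first exact: comb.
  move=> w w01; rewrite -mulrBl normrM.
  rewrite -[leRHS](divfK (lt0r_neq0 M0)).
  by apply: ler_pM => //; [exact: kl | exact: hM].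
have kernel_mul s k : 0 < s -> kernel_approx k ->
    kernel_approx (fun w => stieltjes_kernel s w * k w).
  move=> s0 ka.
  apply: (@kernel_approx_ext (fun w => k w * stieltjes_kernel s w)).
    by move=> w _; rewrite mulrC.
  apply: step ka => [a l lpos|]; last exact: kernel_approx_kernel.
  apply: (@kernel_approx_ext (fun w => a * stieltjes_kernel s w +
     \sum_(x <- l) x.1 * (stieltjes_kernel x.2 w * stieltjes_kernel s w))).
    move=> w _; rewrite /kernel_comb mulrDl big_distrl /=; congr (_ + _).
    by apply: eq_bigr => x _; rewrite mulrA.
  apply: kernel_approxD; first exact/kernel_approxZ/kernel_approx_kernel.
  apply: kernel_approx_sum lpos _ => x x0.
  exact/kernel_approxZ/kernel_approx_mul_kernel.
move=> ga ga'; apply: step ga => // a l lpos.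
apply: (@kernel_approx_ext (fun w => a * g' w +
   \sum_(x <- l) x.1 * (stieltjes_kernel x.2 w * g' w))).
  move=> w _; rewrite /kernel_comb mulrDl big_distrl /=; congr (_ + _).
  by apply: eq_bigr => x _; rewrite mulrA.
apply: kernel_approxD; first exact: kernel_approxZ.
apply: kernel_approx_sum lpos _ => x x0.
exact/kernel_approxZ/kernel_mul.
Qed.

Lemma kernel_approx_id : kernel_approx id.
Proof.
apply: kernel_approx_ext (kernel_approx_kernel ltr01) => w _.
by rewrite /stieltjes_kernel mul1r addrC subrK divr1.
Qed.

(** The Bernstein polynomial of a function with values [f k] at the nodes, that
    is, the expectation of [f] under a binomial law of parameters [N] and [w],
    by the recursion of de Casteljau.  In this form linearity, positivity and
    the second moment are inductions without binomial sums. *)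
Fixpoint bernstein N (f : nat -> R) w : R :=
  if N is N'.+1 then
    (1 - w) * bernstein N' f w + w * bernstein N' (f \o succn) w
  else f 0%N.

Lemma kernel_approx_bernstein N f : kernel_approx (bernstein N f).
Proof.
elim: N f => [|N IH] f; first exact: kernel_approx_cst.
apply: kernel_approxD; apply: kernel_approxM => //; last exact: kernel_approx_id.
apply: kernel_approxD; first exact: kernel_approx_cst.
apply: kernel_approx_ext (kernel_approxZ (-1) kernel_approx_id) => w _.
by rewrite mulN1r.
Qed.

Lemma bernstein_le N f f' w : w \in `[0, 1] ->
  (forall k, (k <= N)%N -> f k <= f' k) -> bernstein N f w <= bernstein N f' w.
Proof.
rewrite in_itv /= => /andP[w0 w1].
elim: N f f' => [|N IH] f f' ff' /=; first exact: ff'.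
apply: lerD; apply: ler_wpM2l; rewrite ?subr_ge0 //; apply: IH => k kN.
  by apply: ff'; exact: leqW.
exact: ff'.
Qed.

(** The second moment of a binomial law about an arbitrary centre [- a]. *)
Lemma bernstein_square N A K a w :
  bernstein N (fun k => A + K * (k%:R + a) ^+ 2) w =
  A + K * (N%:R * w * (1 - w) + (N%:R * w + a) ^+ 2).
Proof.
elim: N a => [|N IH] a /=; first by rewrite !mul0r !add0r.
have -> : (fun k => A + K * (k%:R + a) ^+ 2) \o succn =
    fun k : nat => A + K * (k%:R + (a + 1)) ^+ 2.
  by apply/funext => k /=; rewrite -natr1; congr (_ + _ * _ ^+ 2); ring.
by rewrite !IH -natr1; ring.
Qed.

Lemma uniform_continuity_itv g eps : 0 < eps ->
  {in `[0, 1], forall w, forall e, 0 < e ->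
     \forall v \near w, v \in `[0, 1] -> `|g v - g w| <= e} ->
  exists2 d, 0 < d & {in `[0, 1] &, forall v w, `|v - w| < d -> `|g v - g w| <= eps}.
Proof.
move=> eps0 gcont.
pose P (d x : R) := forall v : R, v \in `[0, 1] -> x \in `[0, 1] -> `|v - x| < d ->
  `|g v - g x| <= eps.
have covering (x : R) : `[0, 1]%classic x ->
    \forall x' \near x & d \near (0 : R)^'+, P d x'.
  rewrite /= => x01; have eps20 : 0 < eps / 2 by lra.
  have /nbhs_ballP[r /= r0 gr] := gcont x x01 _ eps20.
  exists (ball x (r / 2), [set d | d < r / 2]).
    split; first by apply: nbhsx_ballx; lra.
    by apply: nbhs_right_lt; lra.
  move=> [x' d] /= [xx' dr] v v01 x'01 vx'.
  have gx' : `|g x' - g x| <= eps / 2.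
    by apply: gr => //; apply: le_ball xx'; lra.
  have gv : `|g v - g x| <= eps / 2.
    apply: gr => //; rewrite /ball /= in xx' *.
    have -> : x - v = (x - x') - (v - x') by ring.
    by rewrite (le_lt_trans (ler_normB _ _)) //; lra.
  have -> : g v - g x' = (g v - g x) - (g x' - g x) by ring.
  by rewrite (le_trans (ler_normB _ _)) //; lra.
have := (iffLR (compact_near_coveringP _) (@segment_compact R 0 1)) _ _ P _ covering.
move=> near0; near (0 : R)^'+ => d; exists d; first by near: d; exact: nbhs_right_gt.
move=> v w v01 w01 vw; have : `[0, 1]%classic `<=` P d by near: d; exact: near0.
by move=> /(_ w w01); apply.
Unshelve. all: by end_near.
Qed.


(** Bernstein's proof of the theorem of Weierstrass: at nodes close to [w] use
    uniform continuity, at the others dominate the oscillation by a multiple of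
    the squared distance, whose mean is of order [1 / N]. *)
Lemma kernel_approx_continuous g M :
  {in `[0, 1], forall w, `|g w| <= M} ->
  {in `[0, 1], forall w, forall e, 0 < e ->
     \forall v \near w, v \in `[0, 1] -> `|g v - g w| <= e} ->
  kernel_approx g.
Proof.
move=> gM gcont; apply: kernel_approx_lim => eps eps0.
have eps20 : 0 < eps / 2 by lra.
have [d d0 gd] := uniform_continuity_itv eps20 gcont.
have M0 : 0 <= M.
  by rewrite (le_trans _ (gM 0 _)) // in_itv /= lexx ler01.
pose K := 2 * M / d ^+ 2.
have d20 : 0 < d ^+ 2 by rewrite exprn_gt0.
have K0 : 0 <= K by rewrite divr_ge0 // ?mulr_ge0 // ltW.
pose N := (Num.truncn (2 * K / eps)).+1.
have N0 : 0 < N%:R :> R by rewrite ltr0n.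
have KN : K / N%:R <= eps / 2.
  rewrite ler_pdivrMr //; have : 2 * K / eps < N%:R by exact: truncnS_gt.
  by rewrite ltr_pdivrMr //; lra.
exists (bernstein N (fun k => g (k%:R / N%:R))).
  exact: kernel_approx_bernstein.
move=> w w01; move: (w01); rewrite in_itv /= => /andP[w0 w1].
have dev k : (k <= N)%N -> `|g w - g (k%:R / N%:R)| <=
    eps / 2 + K / N%:R ^+ 2 * (k%:R + - (N%:R * w)) ^+ 2.
  move=> kN; have k01 : (k%:R / N%:R : R) \in `[0, 1].
    by rewrite in_itv /= divr_ge0 //= ler_pdivrMr // mul1r ler_nat.
  have -> : K / N%:R ^+ 2 * (k%:R + - (N%:R * w)) ^+ 2 = K * (w - k%:R / N%:R) ^+ 2.
    by field; rewrite gt_eqF.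
  have sq0 : 0 <= K * (w - k%:R / N%:R) ^+ 2 by rewrite mulr_ge0 // sqr_ge0.
  have [near|far] := ltP `|w - k%:R / N%:R| d.
    by rewrite (le_trans (gd _ _ w01 k01 near)) // lerDl.
  have : 2 * M <= K * (w - k%:R / N%:R) ^+ 2.
    rewrite /K mulrAC ler_pdivlMr // ler_wpM2l ?mulr_ge0 //.
    by rewrite -[leRHS]real_normK ?num_real //; apply: lerXn2r; rewrite ?nnegrE ?(ltW d0).
  have := gM w w01; have := gM _ k01; have := ler_normB (g w) (g (k%:R / N%:R)).
  lra.
have total : K / N%:R ^+ 2 * (N%:R * w * (1 - w) + (N%:R * w + - (N%:R * w)) ^+ 2)
    <= eps / 2.
  rewrite subrr expr0n addr0.
  have -> : K / N%:R ^+ 2 * (N%:R * w * (1 - w)) = K / N%:R * (w * (1 - w)).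
    by field; rewrite gt_eqF.
  apply: le_trans KN; rewrite -[leRHS]mulr1; apply: ler_wpM2l.
    by apply: divr_ge0 => //; exact: ltW.
  by apply: mulr_ile1; lra.
have upper : bernstein N (fun k => g (k%:R / N%:R)) w <= g w + eps.
  apply: (@le_trans _ _ (bernstein N (fun k => (g w + eps / 2) +
      K / N%:R ^+ 2 * (k%:R + - (N%:R * w)) ^+ 2) w)).
    by apply: bernstein_le => // k /dev; rewrite ler_norml => /andP[]; lra.
  by rewrite bernstein_square; lra.
have lower : g w - eps <= bernstein N (fun k => g (k%:R / N%:R)) w.
  apply: (@le_trans _ _ (bernstein N (fun k => (g w - eps / 2) +
      - (K / N%:R ^+ 2) * (k%:R + - (N%:R * w)) ^+ 2) w)).
    by rewrite bernstein_square mulNr; lra.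
  by apply: bernstein_le => // k /dev; rewrite mulNr ler_norml => /andP[]; lra.
by rewrite ler_distlC lower upper.
Qed.

End stieltjes_kernels.

(** * Limits of quantile functions *)

Section quantiles.
Variable R : realType.
Implicit Types (F : R -> R) (s : seq R).

Local Notation U01 := (uniform_prob (@ltr01 R)).

Lemma uniform_prob_itv (x y : R) : 0 <= x -> x <= y -> y <= 1 ->
  U01 `[x, y[%classic = (y - x)%:E.
Proof.
move=> x0 xy y1; rewrite /uniform_prob integral_uniform_pdf setIidl; last first.
  move=> p /=; rewrite !in_itv /= => /andP[xp py].
  by rewrite (le_trans x0 xp) /= ltW // (lt_le_trans py).
rewrite (eq_integral (cst 1%E)).
  rewrite integral_cst // mul1e; apply: eq_trans (lebesgue_measure_itv _) _.
  rewrite /= lte_fin; case: ltP => // yx.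
  by have -> : y = x; [apply/eqP; rewrite eq_le xy yx | rewrite subrr].
move=> p; rewrite inE /= in_itv /= => /andP[xp py].
by rewrite /uniform_pdf subr0 invr1 (le_trans x0 xp) ltW // (lt_le_trans py).
Qed.

Lemma uniform_integrable F (M : R) (D : set (measurableTypeR R)) :
  measurable D -> measurable_fun setT F ->
  (forall p, `|F p| <= M) -> U01.-integrable D (EFin \o F).
Proof.
move=> mD mF FM; apply: measurable_bounded_integrable => //.
- by apply: le_lt_trans (probability_le1 U01 mD) _; rewrite ltry.
- exact: measurable_funTS.
- exists M; split; rewrite ?num_real // => x Mx y _ /=.
  by rewrite (le_trans (FM y)) // ltW.
Qed.

Lemma Rintegral_itv_step F (C : R) M (a b : nat -> R) : (0 < M)%N ->
  measurable_fun setT F -> (forall p, `|F p| <= C) ->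
  (forall j p, (j < M)%N -> j%:R / M%:R <= p -> p < j.+1%:R / M%:R ->
     a j <= F p <= b j) ->
  (\sum_(j < M) a j) / M%:R <= \int[U01]_(p in `[0, 1[) F p <=
    (\sum_(j < M) b j) / M%:R.
Proof.
move=> M0 mF FC Fab; have MR : 0 < M%:R :> R by rewrite ltr0n.
suff ind m : (m <= M)%N ->
    (\sum_(j < m) a j) / M%:R <= \int[U01]_(p in `[0, m%:R / M%:R[) F p <=
    (\sum_(j < m) b j) / M%:R.
  by have := ind M (leqnn M); rewrite divff // gt_eqF.
elim: m => [_|m IH mM].
  by rewrite !big_ord0 !mul0r set_itvco0 Rintegral_set0 lexx.
have /andP[IHa IHb] := IH (ltnW mM).
have mmS : m%:R / M%:R <= m.+1%:R / M%:R :> R.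
  by rewrite ler_pM2r ?invr_gt0 // ler_nat.
have m0 : 0 <= m%:R / M%:R :> R by rewrite divr_ge0.
have mS1 : m.+1%:R / M%:R <= 1 :> R by rewrite ler_pdivrMr // mul1r ler_nat.
have int D : measurable D -> U01.-integrable D (EFin \o F).
  by move=> mD; exact: (uniform_integrable mD mF FC).
have split : `[0, m.+1%:R / M%:R[%classic =
    `[0, m%:R / M%:R[%classic `|` `[m%:R / M%:R, m.+1%:R / M%:R[%classic :> set R.
  by apply: itv_bndbnd_setU; rewrite bnd_simp.
rewrite split Rintegral_setU //; first last.
- apply/eqP; rewrite -subset0 => p [] /=.
  by rewrite !in_itv /= => /andP[_ h1] /andP[]; rewrite leNgt h1.
- by apply: int; apply: measurableU.
rewrite !big_ord_recr /= !mulrDl.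
have cstE (r : R) : r / M%:R =
    \int[U01]_(p in `[m%:R / M%:R, m.+1%:R / M%:R[) (cst r p).
  rewrite Rintegral_cst //= uniform_prob_itv //= -mulrBl -natrB ?leqnSn //.
  by rewrite subSnn mul1r.
have Fabm p : p \in `[m%:R / M%:R, m.+1%:R / M%:R[ -> a m <= F p <= b m.
  by rewrite in_itv /= => /andP[? ?]; apply: Fab.
have intc (r : R) : U01.-integrable `[m%:R / M%:R, m.+1%:R / M%:R[ (EFin \o cst r).
  by apply: (@uniform_integrable _ `|r|).
apply/andP; split; apply: lerD => //; rewrite cstE; apply: le_Rintegral => //;
  try exact: int; by move=> p /= /Fabm /andP[].
Qed.

(** The lower and upper Riemann sums of a monotone function differ by a telescoping
    sum; the point is that the error bound does not depend on [F]. *)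
Lemma Rintegral_nonincreasing F M : (0 < M)%N -> nonincreasing_fun F ->
  (forall p, 0 <= F p <= 1) ->
  `|\int[U01]_(p in `[0, 1[) F p - (\sum_(j < M) F (j%:R / M%:R)) / M%:R|
    <= M%:R^-1.
Proof.
move=> M0 Fni F01; have MR : 0 < M%:R :> R by rewrite ltr0n.
have mF : measurable_fun setT F by exact: nonincreasing_measurable.
have FC p : `|F p| <= 1 by have /andP[h1 h2] := F01 p; rewrite ger0_norm.
have step j p : (j < M)%N -> j%:R / M%:R <= p -> p < j.+1%:R / M%:R ->
    F (j.+1%:R / M%:R) <= F p <= F (j%:R / M%:R).
  by move=> _ jp pj; rewrite !Fni // ltW.
have /andP[lo up] := @Rintegral_itv_step F 1 M (fun j => F (j.+1%:R / M%:R))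
  (fun j => F (j%:R / M%:R)) M0 mF FC step.
have tele : \sum_(j < M) F (j%:R / M%:R) - 1 <= \sum_(j < M) F (j.+1%:R / M%:R).
  have := telescope_sumr (fun j => F (j%:R / M%:R)) (leq0n M).
  rewrite big_mkord sumrB.
  have /andP[h1 _] := F01 (M%:R / M%:R); have /andP[_ h2] := F01 (0%:R / M%:R).
  by lra.
rewrite ler_norml; apply/andP; split; last first.
  by rewrite lerBlDr (le_trans up) // lerDr invr_ge0.
rewrite lerBrDr; apply: le_trans lo; set S := \sum_(j < M) F (j%:R / M%:R).
have -> : - M%:R^-1 + S / M%:R = (S - 1) / M%:R by ring.
by rewrite ler_pM2r ?invr_gt0.
Qed.

(** The values are sorted in decreasing order, so that [quantile s] is
    nonincreasing on the whole line: below [0] it is the largest value, and from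
    [1] on it is the default value [0]. *)
Definition quantile s (p : R) : R := nth 0 (sort >=%R s) (Num.truncn (p * (size s)%:R)).

Lemma quantile_itv s p : {in s, forall w, w \in `[0, 1]} -> 0 <= quantile s p <= 1.
Proof.
move=> s01; rewrite /quantile; set i := Num.truncn _.
have [si|si] := leqP (size (sort >=%R s)) i; first by rewrite nth_default // lexx ler01.
have : nth 0 (sort >=%R s) i \in s by rewrite -(mem_sort >=%R) mem_nth.
by move=> /s01; rewrite in_itv.
Qed.

Lemma quantile_nonincreasing s : {in s, forall w, w \in `[0, 1]} ->
  nonincreasing_fun (quantile s).
Proof.
move=> s01 p p' pp'; have /andP[q0 _] := quantile_itv p s01.
rewrite /quantile in q0 *; set t := sort _ s in q0 *.
set i := Num.truncn (p * _) in q0 *; set i' := Num.truncn (p' * _).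
have ii' : (i <= i')%N by apply: le_truncn; rewrite ler_wpM2r.
have [si|si] := leqP (size t) i'; first by rewrite [leLHS]nth_default.
have ge_trans : transitive (>=%R : rel R) by move=> x y z h1 h2; exact: le_trans h2 h1.
apply: (sorted_leq_nth ge_trans (@lexx _ _) 0 (sort_sorted _ s)) => //.
by rewrite inE; exact: leq_ltn_trans si.
Qed.

Lemma Rintegral_quantile s (h : R -> R) : (0 < size s)%N ->
  {in s, forall w, w \in `[0, 1]} ->
  {in `[0, 1], forall w, 0 <= h w <= 1} ->
  {in `[0, 1] &, {homo h : x y / x <= y}} ->
  \int[U01]_(p in `[0, 1[) h (quantile s p) = (\sum_(w <- s) h w) / (size s)%:R.
Proof.
move=> s0 s01 h01 hnd; have q01 p : quantile s p \in `[0, 1].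
  by rewrite in_itv; exact: quantile_itv.
have sR : 0 < (size s)%:R :> R by rewrite ltr0n.
have mF : measurable_fun setT (h \o quantile s).
  apply: nonincreasing_measurable => // p p' pp'.
  by apply: hnd => //; exact: quantile_nonincreasing.
have FC p : `|(h \o quantile s) p| <= 1.
  by have /andP[h1 h2] := h01 _ (q01 p); rewrite ger0_norm.
pose a j := h (nth 0 (sort >=%R s) j).
have step j p : (j < size s)%N -> j%:R / (size s)%:R <= p ->
    p < j.+1%:R / (size s)%:R -> a j <= (h \o quantile s) p <= a j.
  move=> _ jp pj; suff -> : (h \o quantile s) p = a j by rewrite lexx.
  rewrite /a /= /quantile; congr (h (nth _ _ _)); apply/eqP; rewrite truncn_eq //.
    by rewrite -ler_pdivrMr // -ltr_pdivlMr // jp pj.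
  by rewrite mulr_ge0 // (le_trans _ jp) // divr_ge0.
have := @Rintegral_itv_step _ 1 _ a a s0 mF FC step.
rewrite -eq_le => /eqP <-; congr (_ / _).
have -> : \sum_(w <- s) h w = \sum_(w <- sort >=%R s) h w.
  by apply: perm_big; rewrite perm_sym perm_sort.
by rewrite (big_nth 0) size_sort big_mkord.
Qed.

Lemma ultrafilter_cvg_itv (T : Type) (U : set_system T) (x : T -> R) :
  UltraFilter U -> (forall t, 0 <= x t <= 1) ->
  exists2 l : R, 0 <= l <= 1 & x @ U --> l.
Proof.
move=> UU x01; have UP : ProperFilter U by exact: ultra_proper.
have cpt := @segment_compact R 0 1.
have xU : (x @ U) `[0, 1]%classic.
  by apply: (@filterE _ U) => t; rewrite /= in_itv /= x01.
have [l []] := cpt (x @ U) _ xU.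
rewrite /= in_itv /= => l01 cl; exists l => // B Bl.
have [//|UnB] := in_ultra_setVsetC (x @^-1` B) UU.
by have [y []] := cl (~` B) B UnB Bl.
Qed.

(** A substitute for Helly's selection theorem: along an ultrafilter the quantile
    functions converge at every point.  Pointwise limits along ultrafilters do
    not commute with integrals in general, but here the integrals are within
    [1 / M] of Riemann sums with [M] terms, and finite sums do pass to the
    limit. *)
Lemma limit_quantile (ws : nat -> seq R) : (forall n, size (ws n) = n) ->
  (forall n, {in ws n, forall w, w \in `[0, 1]}) ->
  exists q : R -> R, [/\ nonincreasing_fun q, forall p, 0 <= q p <= 1 &
    forall (h : R -> R) (A : R), {in `[0, 1], forall w, 0 <= h w <= 1} ->
      {in `[0, 1] &, {homo h : x y / x <= y}} ->
      {in `[0, 1], forall w, {for w, continuous h}} ->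
      (\sum_(w <- ws n) h w) / n%:R @[n --> \oo] --> A ->
      \int[U01]_(p in `[0, 1[) h (q p) = A].
Proof.
move=> szws ws01.
have [U [UU leU]] := @ultraFilterLemma nat \oo _.
have UP : ProperFilter U by exact: ultra_proper.
have /choice[q qP] : forall p, exists l : R,
    0 <= l <= 1 /\ quantile (ws n) p @[n --> U] --> l.
  move=> p; have [|l l01 lP] := @ultrafilter_cvg_itv _ U (fun n => quantile (ws n) p) UU.
    by move=> n; apply: quantile_itv; exact: ws01.
  by exists l.
have q01 p : 0 <= q p <= 1 by have [] := qP p.
have q_ni : nonincreasing_fun q.
  move=> p p' pp'; apply: ler_cvg_to (proj2 (qP p')) (proj2 (qP p)) _.
  by apply: nearW => n; exact: quantile_nonincreasing.
exists q; split => // h A h01 hnd hcont hA.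
have q01' p : q p \in `[0, 1] by rewrite in_itv; exact: q01.
have qn01 n p : quantile (ws n) p \in `[0, 1].
  by rewrite in_itv; apply: quantile_itv; exact: ws01.
have riemann M : (0 < M)%N -> `|\int[U01]_(p in `[0, 1[) h (q p) - A| <= 2 / M%:R.
  move=> M0; pose S n := (\sum_(j < M) h (quantile (ws n) (j%:R / M%:R))) / M%:R.
  pose T := (\sum_(j < M) h (q (j%:R / M%:R))) / M%:R.
  have ST : S n @[n --> U] --> T.
    apply: cvgM; last exact: cvg_cst.
    apply: cvg_big => [x|j _]; first exact: add_continuous.
    apply: continuous_cvg; first exact: hcont.
    exact: (proj2 (qP _)).
  have hqT : `|\int[U01]_(p in `[0, 1[) h (q p) - T| <= M%:R^-1.
    apply: Rintegral_nonincreasing => // [p p' pp'|p]; last exact: h01.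
    by apply: hnd => //; exact: q_ni.
  have AT : `|T - A| <= M%:R^-1.
    have cvgN : `|S n - (\sum_(w <- ws n) h w) / n%:R| @[n --> U] --> `|T - A|.
      apply: cvg_norm; apply: cvgB => //.
      by apply: cvg_trans hA; apply: cvg_app.
    apply: ler_cvg_to cvgN (cvg_cst _) _.
    apply: leU; exists 1%N => // n /= n0.
    rewrite distrC -[in X in _ / X](szws n) -Rintegral_quantile ?szws //.
    apply: Rintegral_nonincreasing => // [p p' pp'|p]; last exact: h01.
    by apply: hnd => //; apply: quantile_nonincreasing.
  have -> : \int[U01]_(p in `[0, 1[) h (q p) - A =
    (\int[U01]_(p in `[0, 1[) h (q p) - T) + (T - A) by ring.
  by rewrite (le_trans (ler_normD _ _)) //; lra.
apply/eqP; rewrite -subr_eq0 -normr_eq0 eq_le normr_ge0 andbT.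
apply/ler_addgt0Pl => e e0; rewrite addr0.
near \oo => M; have M0 : (0 < M)%N by near: M; exists 1%N.
apply: le_trans (riemann M M0) _; rewrite ler_pdivrMr ?ltr0n //.
by rewrite mulrC -ler_pdivrMr // ltW //; near: M; exact: nbhs_infty_gtr.
Unshelve. all: by end_near.
Qed.

End quantiles.

(** * The zeros of the polynomials and their means *)

Section zeros.
Variable R : realType.
Implicit Types (b s : R) (n c : nat) (p : {poly R}).
Local Notation rc := (real_complex R).

Definition real_zeros p : seq R := [seq complex.Re z | z <- croots (map_poly rc p)].

Lemma crootsE (P : {poly R[i]}) :
  P = lead_coef P *: \prod_(z <- croots P) ('X - z%:P).
Proof. exact: svalP (closed_field_poly_normal P). Qed.

Lemma croots_nonneg p : p != 0 -> nonneg_roots (map_poly rc p) ->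
  {in croots (map_poly rc p), forall z, 0 <= complex.Re z /\ z = rc (complex.Re z)}.
Proof.
move=> p0 nonneg z zP.
have : 0 <= z.
  apply: nonneg; rewrite [X in root X _]crootsE.
  rewrite rootZ; last by rewrite lead_coef_eq0 map_poly_eq0.
  by rewrite root_prod_XsubC.
by case: z {zP} => x y; rewrite lecE /= => /andP[/eqP -> ->].
Qed.

Lemma real_zeros_ge0 p : p != 0 -> nonneg_roots (map_poly rc p) ->
  {in real_zeros p, forall r, 0 <= r}.
Proof. by move=> p0 nonneg _ /mapP[z /(croots_nonneg p0 nonneg)[? _] ->]. Qed.

Lemma real_zerosE p : p != 0 -> nonneg_roots (map_poly rc p) ->
  p = lead_coef p *: \prod_(r <- real_zeros p) ('X - r%:P).
Proof.
move=> p0 nonneg; apply: (map_poly_inj rc).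
rewrite [LHS]crootsE.
rewrite linearZ /= lead_coef_map rmorph_prod /= big_map; congr (_ *: _).
apply: eq_big_seq => z /(croots_nonneg p0 nonneg)[_ {1}->].
by rewrite rmorphB /= map_polyX map_polyC.
Qed.

(** The logarithmic derivative at [- s], cleared of its denominator. *)
Lemma sum_real_zeros p s : p != 0 -> nonneg_roots (map_poly rc p) -> 0 < s ->
  (\sum_(r <- real_zeros p) s / (s + r)) * p.[- s] = - s * p^`().[- s].
Proof.
move=> p0 nonneg s0.
have sN : - s \notin real_zeros p.
  by apply/negP => /(real_zeros_ge0 p0 nonneg); rewrite oppr_ge0 leNgt s0.
rewrite {2 3}(real_zerosE p0 nonneg) derivZ !hornerZ horner_deriv_prod_XsubC //.
have -> : \sum_(r <- real_zeros p) s / (s + r) =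
    - s * \sum_(r <- real_zeros p) (- s - r)^-1.
  rewrite big_distrr /=; apply: eq_bigr => r _.
  by rewrite -opprD invrN mulrNN.
by ring.
Qed.

Lemma PpolyE n b c : Ppoly n b c%:R =
  \poly_(k < n.+1) ((-1) ^+ (n - k) * 'C(n, k)%:R * `|k%:R + b| ^+ c).
Proof. by apply: eq_poly => k _; rewrite powR_mulrn. Qed.

(** For [b <= - n] all [k + b] are nonpositive, and dropping the absolute values
    costs the global sign [(-1) ^+ c]. *)
Lemma Ppoly_euler n b c : 0 <= b \/ b <= - n%:R ->
  exists2 e : R[i], e != 0 &
    map_poly rc (Ppoly n b c%:R) = e *: euler_poly n (rc b) c.
Proof.
move=> hb; exists (rc ((-1) ^+ c) ^+ (b < 0)%R).
  by rewrite expf_neq0 // fmorph_eq0 expf_neq0 // oppr_eq0 oner_eq0.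
apply/polyP => k; rewrite PpolyE coef_map coefZ coef_euler_poly coef_poly.
case: ltnP => [|nk]; last by rewrite bin_small // rmorph0 mulr0 mul0r mulr0.
rewrite ltnS => kn; have knR : k%:R <= n%:R :> R by rewrite ler_nat.
have -> : `|k%:R + b| ^+ c = ((-1) ^+ c) ^+ (b < 0)%R * (k%:R + b) ^+ c.
  case: ltP => hb0; last by rewrite ger0_norm ?expr0 ?mul1r // addr_ge0.
  rewrite ler0_norm; first by rewrite expr1 -exprMn mulN1r.
  by case: hb => ?; lra.
rewrite -[LHS]/(rc _) !rmorphM !rmorphXn rmorphN rmorph1 rmorphD !rmorph_nat.
ring.
Qed.

Lemma nonneg_roots_Ppoly n b c : (0 < n)%N -> 0 <= b \/ b <= - n%:R ->
  Ppoly n b c%:R != 0 /\ nonneg_roots (map_poly rc (Ppoly n b c%:R)).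
Proof.
move=> n0 hb; have [e e0 PE] := Ppoly_euler c hb.
have hbC : 0 <= rc b \/ rc b <= - n%:R.
  rewrite -(rmorph_nat rc) -rmorphN -(rmorph0 rc) !lecR.
  exact: hb.
split; first by rewrite -(map_poly_eq0 rc) PE scaler_eq0 negb_or e0 euler_poly_neq0.
by move=> z; rewrite PE rootZ //; exact: nonneg_roots_euler_poly.
Qed.

Lemma horner_Ppoly n b c s : 0 <= s -> (Ppoly n b c%:R).[- s] =
  (-1) ^+ n * \sum_(k < n.+1) weight n b c s k.
Proof.
move=> s0; rewrite PpolyE horner_poly big_distrr; apply: eq_bigr => k _ /=.
have kn : (k <= n)%N by rewrite -ltnS.
have -> : (-1) ^+ n = (-1) ^+ (n - k) * (-1) ^+ k :> R by rewrite -exprD subnK.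
by rewrite [(- s) ^+ k]exprNn /weight; ring.
Qed.

Lemma horner_deriv_Ppoly n b c s : 0 <= s -> - s * (Ppoly n b c%:R)^`().[- s] =
  (-1) ^+ n * \sum_(k < n.+1) k%:R * weight n b c s k.
Proof.
move=> s0; rewrite -[X in X * _]hornerX -hornerM.
have -> : 'X * (Ppoly n b c%:R)^`() =
    \poly_(k < n.+1) (k%:R * ((-1) ^+ (n - k) * 'C(n, k)%:R * `|k%:R + b| ^+ c)).
  rewrite PpolyE; apply/polyP => -[|k]; rewrite coefXM /= ?coef_deriv !coef_poly /=.
    by rewrite mul0r.
  case: ifP => _; last by rewrite mul0rn.
  by rewrite mulr_natl.
rewrite horner_poly big_distrr; apply: eq_bigr => k _ /=.
have kn : (k <= n)%N by rewrite -ltnS.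
have -> : (-1) ^+ n = (-1) ^+ (n - k) * (-1) ^+ k :> R by rewrite -exprD subnK.
by rewrite [(- s) ^+ k]exprNn /weight; ring.
Qed.

Lemma sum_zeros_Ppoly n b c s : (0 < n)%N -> 0 <= b \/ b <= - n%:R -> 0 < s ->
  (\sum_(r <- real_zeros (Ppoly n b c%:R)) s / (s + r)) / n%:R =
  scaled_mean n b c s.
Proof.
move=> n0 hb s0; have [P0 nonneg] := nonneg_roots_Ppoly c n0 hb.
have := sum_real_zeros P0 nonneg s0.
rewrite horner_Ppoly ?horner_deriv_Ppoly ?(ltW s0) // mulrCA.
move=> /(mulfI _) sumE; rewrite /scaled_mean -sumE; last first.
  by rewrite expf_neq0 // oppr_eq0 oner_eq0.
have W0 := sum_weight_gt0 b c n0 s0.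
by field; rewrite (lt0r_neq0 W0) pnatr_eq0 -lt0n.
Qed.

(** The zeros in the coordinate [w = 1 / (1 + u)], each zero at infinity being
    listed as [w = 0].  The case [n = 0], where the polynomial may vanish, is set
    apart so that there are always [n] points. *)
Definition zero_coords n p : seq R :=
  if (0 < n)%N then
    [seq (1 + r)^-1 | r <- real_zeros p] ++ nseq (n - (size p).-1) 0
  else [::].

Lemma size_real_zeros p : p != 0 -> nonneg_roots (map_poly rc p) ->
  size (real_zeros p) = (size p).-1.
Proof.
move=> p0 nonneg; rewrite [in RHS](real_zerosE p0 nonneg).
by rewrite size_scale ?lead_coef_eq0 // size_prod_XsubC.
Qed.

Lemma size_zero_coords n b c : 0 <= b \/ b <= - n%:R ->
  size (zero_coords n (Ppoly n b c%:R)) = n.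
Proof.
move=> hb; rewrite /zero_coords; case: ltnP => [n0|]; last by case: n hb.
have [P0 nonneg] := nonneg_roots_Ppoly c n0 hb.
rewrite size_cat size_map size_nseq size_real_zeros // subnKC //.
by rewrite -subn1 leq_subLR add1n; exact: size_poly.
Qed.

Lemma zero_coords_itv n b c : 0 <= b \/ b <= - n%:R ->
  {in zero_coords n (Ppoly n b c%:R), forall w, w \in `[0, 1]}.
Proof.
move=> hb w; rewrite /zero_coords; case: ltnP => [n0|//].
have [P0 nonneg] := nonneg_roots_Ppoly c n0 hb.
rewrite mem_cat in_itv /= => /orP[/mapP[r /(real_zeros_ge0 P0 nonneg) r0 ->]|].
  by rewrite invr_ge0 addr_ge0 //= invf_le1 ?lerDl // ltr_pwDl.
by rewrite mem_nseq => /andP[_ /eqP ->]; rewrite lexx ler01.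
Qed.

Lemma kernel_average n b c s : (0 < n)%N -> 0 <= b \/ b <= - n%:R -> 0 < s ->
  (\sum_(w <- zero_coords n (Ppoly n b c%:R)) stieltjes_kernel s w) / n%:R =
  scaled_mean n b c s.
Proof.
move=> n0 hb s0; rewrite -sum_zeros_Ppoly // /zero_coords n0; congr (_ / _).
have [P0 nonneg] := nonneg_roots_Ppoly c n0 hb.
rewrite big_cat big_map /= [X in _ + X]big_nseq.
have -> : stieltjes_kernel s 0 = 0 by rewrite /stieltjes_kernel mulr0 mul0r.
rewrite iter_addr_0 mul0rn addr0; apply: eq_big_seq => r.
move=> /(real_zeros_ge0 P0 nonneg) r0; rewrite /stieltjes_kernel.
have r1 : 1 + r != 0 by rewrite gt_eqF // ltr_pwDl.
have sr : s + r != 0 by rewrite gt_eqF // ltr_pwDl.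
have -> : s / (1 + r) + (1 - (1 + r)^-1) = (s + r) / (1 + r) by field.
by field; rewrite sr r1.
Qed.

End zeros.

(** * Integrals over the sphere *)

Section sphere_integrals.
Variable R : realType.
Local Notation rc := (real_complex R).
Local Notation S := (Borel (sphere R)).

Lemma measurable_sphere_continuous (f : sphere R -> R) : continuous f ->
  measurable_fun [set: S] (f : S -> measurableTypeR R).
Proof.
move=> /continuousP cf; apply: (measurability _ (RGenOpens.measurableE R)).
move=> _ [_ [a [b ->] <-]]; rewrite setTI; apply: sub_sigma_algebra.
exact/cf/interval_open.
Qed.

Lemma ge0_integral_zero_distribution n (P : {poly R[i]}) (f : S -> \bar R) :
  measurable_fun setT f -> (forall x, 0 <= f x)%E ->
  (\int[zero_distribution n P]_x f x =
   (n%:R^-1)%:E * (\sum_(z <- croots P) f (Some z)) +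
   ((n - (size P).-1)%:R / n%:R)%:E * f None)%E.
Proof.
move=> mf f0; rewrite /zero_distribution.
rewrite ge0_integral_measure_add // !ge0_integral_mscale //=.
rewrite ge0_integral_measure_sum // integral_dirac // diracT mul1e.
congr (_ * _ + _)%E; rewrite (big_nth 0) big_mkord; apply: eq_bigr => i _.
by rewrite integral_dirac // diracT mul1e.
Qed.

(** The formulas for integrals against sums and multiples of measures are for
    nonnegative functions; adding the constant [M] reduces to that case. *)
Lemma Rintegral_zero_distribution n (P : {poly R[i]}) (f : S -> R) (M : R) :
  measurable_fun setT f -> (forall x, `|f x| <= M) ->
  \int[zero_distribution n P]_x f x =
   n%:R^-1 * (\sum_(z <- croots P) f (Some z)) +
   (n - (size P).-1)%:R / n%:R * f None.
Proof.
move=> mf fM; set mu := zero_distribution n P.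
have ge0 (h : S -> R) : measurable_fun setT h -> (forall x, 0 <= h x) ->
    (\int[mu]_x (h x)%:E = (n%:R^-1 * (\sum_(z <- croots P) h (Some z)) +
      (n - (size P).-1)%:R / n%:R * h None)%:E)%E.
  move=> mh h0; rewrite ge0_integral_zero_distribution //.
    by rewrite sumEFin -!EFinM -EFinD.
  exact/measurable_EFinP.
have muT : (mu setT < +oo)%E.
  have -> : mu setT = (\int[mu]_x (cst (1 : R) x)%:E)%E.
    by rewrite -[LHS]mul1e; exact/esym/(integral_cst mu measurableT 1%E).
  by rewrite (ge0 (cst 1)) ?ltry // => x /=; exact: ler01.
have intf (h : S -> R) (C : R) : measurable_fun setT h -> (forall x, `|h x| <= C) ->
    mu.-integrable setT (EFin \o h).
  move=> mh hC; apply: measurable_bounded_integrable => //.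
  exists C; split; rewrite ?num_real // => x Cx y _ /=.
  by rewrite (le_trans (hC y)) // ltW.
have mD : measurable_fun setT (fun x => f x + M) by apply: measurable_funD.
have fM0 x : 0 <= f x + M.
  by have := fM x; rewrite ler_norml => /andP[]; lra.
have -> : \int[mu]_x f x = \int[mu]_x (f x + M) - \int[mu]_x (cst M x).
  rewrite RintegralD //; first by ring.
    exact: (intf _ M).
  by apply: (intf (cst M) `|M|).
have M0 : 0 <= M by rewrite (le_trans _ (fM None)).
rewrite /Rintegral (ge0 _ mD fM0) (ge0 (cst M)) //= ?measurable_cst // big_split /=.
by ring.
Qed.

(** A function on the sphere, along the half-line [[0, +oo]], in the coordinate
    [w = 1 / (1 + u)]. *)
Definition sphere_coord (f : sphere R -> R) (w : R) : R :=
  if w == 0 then f None else f (Some (rc (w^-1 - 1))).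

Lemma sphere_coord_average n b c (f : S -> R) (M : R) : (0 < n)%N ->
  0 <= b \/ b <= - n%:R ->
  measurable_fun setT f -> (forall x, `|f x| <= M) ->
  \int[zero_distribution n (map_poly rc (Ppoly n b c%:R))]_x f x =
  (\sum_(w <- zero_coords n (Ppoly n b c%:R)) sphere_coord f w) / n%:R.
Proof.
move=> n0 hb mf fM; rewrite (Rintegral_zero_distribution _ _ mf fM).
have [P0 nonneg] := nonneg_roots_Ppoly c n0 hb.
rewrite /zero_coords n0 big_cat big_map /= big_nseq iter_addr_0 /real_zeros big_map.
rewrite size_map_poly mulrDl; congr (_ + _).
  rewrite mulrC; congr (_ * _); apply: eq_big_seq => z zP.
  have [r0 zE] := croots_nonneg P0 nonneg zP.
  rewrite /sphere_coord invr_eq0 gt_eqF ?ltr_pwDl // invrK addrC addKr.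
  by rewrite -zE.
by rewrite /sphere_coord eqxx mulrAC mulr_natl.
Qed.

(** A compact set is left for good because, near each of its points [x], a real
    [t > |x| + 1] is excluded; compactness makes this uniform. *)
Lemma some_real_cvg_infty :
  Some (rc t) @[t --> +oo] --> (None : sphere R).
Proof.
move=> A [K [cptK clK] KA].
have cov (x : R[i]^o) : K x -> \forall x' \near x & t \near +oo, x' <> rc t.
  move=> _; exists (ball x 1, [set t | complex.Re `|x| + 1 < t]).
    split; first exact: nbhsx_ballx.
    by apply: nbhs_pinfty_gt; rewrite num_real.
  move=> [x' t] /= [xx' ht] x't; move: xx'; rewrite x't /ball /= distrC.
  pose N := Normc.normc x; rewrite -/N in ht.
  have NE : `|x| = rc N by [].
  have N0 : 0 <= N by have := normr_ge0 x; rewrite NE lecE /= eqxx.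
  have t0 : 0 <= rc t by rewrite lecE /= eqxx /=; lra.
  move=> xt; have : rc t < rc (N + 1).
    rewrite -[ltLHS]ger0_norm // -[rc t in ltLHS](addrNK x).
    rewrite (le_lt_trans (ler_normD _ _)) // addrC rmorphD rmorph1 /= -NE.
    by rewrite ltrD2l.
  by rewrite ltcR; lra.
have /compact_near_coveringP/(_ _ _ _ _ cov) := cptK.
apply: filterS => t Kt; apply: KA; left; exists (rc t) => // Krc.
exact: (Kt _ Krc).
Qed.

Lemma sphere_coord_continuous (f : sphere R -> R) : continuous f ->
  {in `[0, 1], forall w, forall e, 0 < e ->
     \forall v \near w, v \in `[0, 1] -> `|sphere_coord f v - sphere_coord f w| <= e}.
Proof.
move=> cf w w01 e e0; have [->|w0] := eqVneq w 0.
  have infty : (v : R)^-1 - 1 @[v --> (0 : R)^'+] --> +oo.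
    apply/cvgryPgt => M; near=> v.
    have v0 : 0 < v by near: v; exact: nbhs_right_gt.
    have vM : v < (`|M| + 1)^-1.
      by near: v; apply: nbhs_right_lt; rewrite invr_gt0 ltr_wpDl.
    have : `|M| + 1 < v^-1 by rewrite -[ltLHS]invrK ltf_pV2 ?posrE // invr_gt0 ltr_wpDl.
    by have := ler_norm M; lra.
  have lim : f (Some (rc (v^-1 - 1))) @[v --> (0 : R)^'+] --> f None.
    apply: (@continuous_cvg _ _ _ _ _
      (fun v : R => Some (rc (v^-1 - 1)) : sphere R) f); first exact: cf.
    exact: cvg_comp infty some_real_cvg_infty.
  have /cvgrPdist_le/(_ e e0) := lim.
  rewrite near_withinE; apply: filterS => v hv; rewrite in_itv /= => /andP[v0 v1].
  rewrite /sphere_coord eqxx; case: eqVneq => [_|vN0].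
    by rewrite subrr normr0 ltW.
  by rewrite distrC; apply: hv; rewrite /= lt_def vN0.
have lim : f (Some (rc (v^-1 - 1))) @[v --> w] --> f (Some (rc (w^-1 - 1))).
  apply: (@continuous_cvg _ _ _ _ _
    (fun v : R => Some (rc (v^-1 - 1)) : sphere R) f); first exact: cf.
  apply: (@continuous_cvg _ _ _ _ _
    (fun v : R => rc (v^-1 - 1) : R[i]^o) (Some : R[i]^o -> sphere R)).
    exact: one_point_compactification_some_continuous.
  apply: (@continuous_cvg _ _ _ _ _ (fun v : R => v^-1 - 1) (rc : R -> R[i]^o)).
    exact: real_complex_continuous.
  by apply: cvgB; [exact: cvgV | exact: cvg_cst].
have /cvgrPdist_le/(_ e e0) := lim.
move=> hv; have neq : \forall v \near w, v != 0.
  by apply: (@cvgr_neq0 _ _ _ (nbhs w) _ (fun v : R => v) w) => //; exact: cvg_id.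
apply: filterS2 neq hv => v vN0 hv _.
by rewrite /sphere_coord (negPf w0) (negPf vN0) distrC.
Unshelve. all: by end_near.
Qed.

End sphere_integrals.

(** * The limit law *)

Section law.
Variable R : realType.
Implicit Types (s w a : R) (q : R -> R).
Local Notation rc := (real_complex R).
Local Notation U01 := (uniform_prob (@ltr01 R)).

Lemma kernel_homo s : 0 < s ->
  {in `[0, 1] &, {homo stieltjes_kernel s : x y / x <= y}}.
Proof.
move=> s0 w w' w01 w01' ww'; rewrite /stieltjes_kernel.
rewrite ler_pdivrMr ?kernel_den_gt0 // mulrAC ler_pdivlMr ?kernel_den_gt0 //.
have : 0 <= s * (w' - w) by rewrite mulr_ge0 ?subr_ge0 // ltW.
by nra.
Qed.

Lemma kernel_continuous s w : 0 < s -> w \in `[0, 1] ->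
  {for w, continuous (stieltjes_kernel s)}.
Proof.
move=> s0 w01; have D0 := kernel_den_gt0 s0 w01.
have smul : (s * v) @[v --> w] --> s * w by apply: cvgM; [exact: cvg_cst|].
apply: cvgM => //; apply: cvgV; first by rewrite gt_eqF.
by apply: cvgD => //; apply: cvgB => //; exact: cvg_cst.
Qed.

(** The sequences [b n = beta n] and [c n], the integer part of [gamma n], satisfy
    the assumptions of the theorem; any limit of their quantile functions will
    do. *)
Lemma limit_law beta gamma : beta \notin `](-1), 0[ -> 0 < gamma ->
  exists q, [/\ nonincreasing_fun q, forall p, 0 <= q p <= 1 &
    forall a, 0 < a < 1 ->
      \int[U01]_(p in `[0, 1[) stieltjes_kernel (tilt beta gamma a) (q p) = a].
Proof.
move=> hbeta g0.
pose b n : R := beta * n%:R.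
pose c n := Num.truncn (gamma * n%:R).
have hb n : 0 <= b n \/ b n <= - n%:R.
  move: hbeta; rewrite in_itv /= negb_and -!leNgt => /orP[h|h]; [right|left].
    by rewrite -mulN1r ler_wpM2r.
  by rewrite mulr_ge0.
have cvgb : b n / n%:R @[n --> \oo] --> beta.
  apply: cvg_trans (_ : (fun=> beta) @ \oo --> beta); last exact: cvg_cst.
  apply: near_eq_cvg; near=> n.
  have n0 : n%:R != 0 :> R by rewrite pnatr_eq0 -lt0n; near: n; exists 1%N.
  by rewrite /= /b mulfK.
have limV : (n%:R^-1 : R) @[n --> \oo] --> 0.
  by rewrite -(cvg_shiftS (fun n => n%:R^-1 : R)); exact: cvg_harmonic.
have cvgc : (c n)%:R / n%:R @[n --> \oo] --> gamma.
  apply: (@squeeze_cvgr _ _ _ _ (fun n => gamma - n%:R^-1) (fun=> gamma)).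
  - near=> n; have n0 : 0 < n%:R :> R by rewrite ltr0n; near: n; exists 1%N.
    have /truncn_itv /andP[h1 h2] : 0 <= gamma * n%:R by rewrite mulr_ge0 // ltW.
    rewrite ler_pdivlMr // ler_pdivrMr // h1 andbT mulrBl mulVf ?gt_eqF //.
    by rewrite lerBlDr natr1 ltW.
  - by rewrite -[X in _ --> X]subr0; apply: cvgB => //; exact: cvg_cst.
  - exact: cvg_cst.
have [q [q_ni q01 qlim]] := limit_quantile
  (fun n => size_zero_coords (c n) (hb n)) (fun n => zero_coords_itv (hb n)).
exists q; split => // a a01; have s0 := tilt_gt0 beta gamma a01.
apply: qlim.
- by move=> w; exact: kernel_itv.
- exact: kernel_homo.
- by move=> w; exact: kernel_continuous.
- have := scaled_mean_cvg hb hbeta (ltW g0) cvgb cvgc a01.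
  apply: cvg_trans; apply: near_eq_cvg; near=> n.
  by rewrite /= kernel_average //; near: n; exists 1%N.
Unshelve. all: by end_near.
Qed.

(** If [q] vanished from [p0 < 1] on, all kernels would have mean at most [p0],
    while these means take every value in []0, 1[]. *)
Lemma quantile_gt0 beta gamma q : nonincreasing_fun q ->
  (forall p, 0 <= q p <= 1) ->
  (forall a, 0 < a < 1 ->
      \int[U01]_(p in `[0, 1[) stieltjes_kernel (tilt beta gamma a) (q p) = a) ->
  forall p, p < 1 -> 0 < q p.
Proof.
move=> q_ni q01 qE p0 p01; rewrite lt0r; have /andP[-> _] := q01 p0; rewrite andbT.
apply/negP => /eqP qp0.
pose p1 := Num.max p0 0.
have p1P : 0 <= p1 < 1 by rewrite le_max lexx orbT gt_max p01 ltr01.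
have /andP[p10 p11] := p1P.
have q0 p : p1 <= p -> q p = 0.
  move=> p1p; apply/eqP; rewrite eq_le; have /andP[-> _] := q01 p.
  by rewrite andbT -qp0 q_ni // (le_trans _ p1p) // le_max lexx.
pose a := (1 + p1) / 2.
have a01 : 0 < a < 1 by rewrite /a; apply/andP; split; lra.
have s0 := tilt_gt0 beta gamma a01.
have qm p : q p \in `[0, 1] by rewrite in_itv /= q01.
set s := tilt beta gamma a in s0 *.
have mF : measurable_fun setT (stieltjes_kernel s \o q).
  apply: nonincreasing_measurable => // p p' pp'.
  by apply: kernel_homo => //; exact: q_ni.
have FC p : `|(stieltjes_kernel s \o q) p| <= 1.
  by have /andP[h1 h2] := kernel_itv s0 (qm p); rewrite /= ger0_norm.
have := qE a a01; rewrite -/s.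
have int D : measurable D -> U01.-integrable D (EFin \o (stieltjes_kernel s \o q)).
  by move=> mD; exact: (uniform_integrable mD mF FC).
have -> : `[0, 1[%classic = `[0, p1[%classic `|` `[p1, 1[%classic :> set R.
  by apply: itv_bndbnd_setU; rewrite bnd_simp // ltW.
rewrite Rintegral_setU //; first last.
- apply/eqP; rewrite -subset0 => p [] /=.
  by rewrite !in_itv /= => /andP[_ h1] /andP[]; rewrite leNgt h1.
- by apply: int; apply: measurableU.
rewrite [X in _ + X](@eq_Rintegral _ _ _ U01 _ (fun=> 0)); last first.
  move=> p; rewrite inE /= in_itv /= => /andP[/q0 -> _].
  by rewrite /stieltjes_kernel mulr0 mul0r.
rewrite Rintegral_cst //= mul0r addr0 => aE.
suff : a <= p1 by rewrite /a; lra.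
rewrite -aE; apply: (@le_trans _ _ (\int[U01]_(p in `[0, p1[) (cst 1 p))).
  apply: le_Rintegral => //; first exact: int.
    by apply: (@uniform_integrable _ _ 1) => // p; rewrite /= normr1.
  by move=> p _; have /andP[] := kernel_itv s0 (qm p).
rewrite Rintegral_cst //= uniform_prob_itv //= ?subr0 ?mul1r //; exact: ltW.
Qed.

Lemma Rintegral_uniform_distribution d (T : measurableType d)
    (Y : {mfun measurableTypeR R >-> T}) (F : T -> R) (M : R) :
  measurable_fun setT F -> (forall t, `|F t| <= M) ->
  \int[distribution U01 Y]_t F t = \int[U01]_(p in `[0, 1[) F (Y p).
Proof.
move=> mF FM.
have mFY : measurable_fun setT (F \o Y) by exact: measurableT_comp.
have int D : measurable D -> U01.-integrable D (EFin \o (F \o Y)).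
  by move=> mD; apply: (uniform_integrable mD mFY) => p; exact: FM.
rewrite /Rintegral integral_distribution //; last exact: int.
  rewrite (@negligible_integral _ _ _ U01 setT (~` `[0, 1[)) //.
  - by rewrite setTD setCK.
  - exact: measurableC.
  - exact: int.
  - apply: etrans (probability_setC U01 _) _ => //.
    by rewrite [X in (1 - X)%E]uniform_prob_itv // subr0 -EFinB subrr.
exact/measurable_EFinP.
Qed.

End law.

(** * Transforms of the limit law and weak convergence *)

Section conclusion.
Variable R : realType.
Implicit Types (s w a : R) (q : R -> R).
Local Notation rc := (real_complex R).
Local Notation U01 := (uniform_prob (@ltr01 R)).

(** The point [u = 1 / w - 1] with coordinate [w].  Written with [expR] and [ln]
    it is visibly measurable, and it takes the nonnegative value [0] at [w = 0],
    where [ln] is [0]. *)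
Definition of_coord w : R := expR (- ln w) - 1.

Lemma of_coordE w : 0 < w -> of_coord w = w^-1 - 1.
Proof. by move=> w0; rewrite /of_coord expRN lnK. Qed.

Lemma of_coord_ge0 w : w <= 1 -> 0 <= of_coord w.
Proof.
by move=> w1; rewrite subr_ge0 -[leLHS]expR0 ler_expR oppr_ge0 ln_le0.
Qed.

Lemma measurable_of_coord q : nonincreasing_fun q ->
  @measurable_fun _ _ (measurableTypeR R) (measurableTypeR R) setT (of_coord \o q).
Proof.
move=> q_ni; apply: measurable_funB => //.
apply: measurableT_comp; first exact: measurable_expR.
apply: measurableT_comp => //; apply: measurableT_comp.
  exact: measurable_ln.
exact: nonincreasing_measurable.
Qed.

Lemma kernel_of_coord s w : 0 < s -> 0 < w -> w <= 1 ->
  of_coord w * (- s^-1) / (1 - of_coord w * (- s^-1)) = stieltjes_kernel s w - 1.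
Proof.
move=> s0 w0 w1; have D0 : 0 < s * w + (1 - w).
  by apply: kernel_den_gt0 => //; rewrite in_itv /= ltW.
rewrite of_coordE // /stieltjes_kernel; field.
by rewrite !gt_eqF //; have -> : s * w - (1 - w) * -1 = s * w + (1 - w) by ring.
Qed.

(* From here on [nu] is the law of [1 / q - 1] under the uniform law. *)
Variables (beta gamma : R) (q : R -> R).
Hypotheses (hbeta : beta \notin `](-1), 0[) (hgamma : 0 < gamma).
Hypotheses (q_ni : nonincreasing_fun q) (q01 : forall p, 0 <= q p <= 1).
Hypothesis qE : forall a, 0 < a < 1 ->
  \int[U01]_(p in `[0, 1[) stieltjes_kernel (tilt beta gamma a) (q p) = a.
Variable X : {mfun measurableTypeR R >-> measurableTypeR R}.
Hypothesis XE : forall p, X p = of_coord (q p).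

Let nu : probability (measurableTypeR R) R := distribution U01 X.

Let qm p : q p \in `[0, 1]. Proof. by rewrite in_itv /= q01. Qed.

Let q_gt0 p : p < 1 -> 0 < q p.
Proof. exact: quantile_gt0 q_ni q01 qE p. Qed.

Lemma law_nonneg : nu `[0, +oo[%classic = 1%E.
Proof.
have -> : 1%E = U01 setT by rewrite probability_setT.
congr (U01 _); apply/seteqP; split => // p _ /=.
by rewrite in_itv /= andbT XE of_coord_ge0 //; have /andP[] := q01 p.
Qed.

Lemma measurable_kernel_quantile s : 0 < s ->
  measurable_fun setT (stieltjes_kernel s \o q).
Proof.
move=> s0; apply: nonincreasing_measurable => // p p' pp'.
by apply: kernel_homo => //; exact: q_ni.
Qed.

Lemma kernel_quantile_integrable s : 0 < s ->
  U01.-integrable `[0, 1[ (EFin \o (stieltjes_kernel s \o q)).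
Proof.
move=> s0; apply: (@uniform_integrable _ _ 1) => //.
  exact: measurable_kernel_quantile.
by move=> p; have /andP[h1 h2] := kernel_itv s0 (qm p); rewrite /= ger0_norm.
Qed.

(** At [z = - 1 / s] the integrand [u z / (1 - u z)] of [psi] is
    [s / (s + u) - 1]. *)
Lemma psi_law a : 0 < a < 1 -> psi nu (- (tilt beta gamma a)^-1) = a - 1.
Proof.
move=> a01; have s0 := tilt_gt0 beta gamma a01; have aE := qE a01.
set s := tilt beta gamma a in s0 aE *.
pose F (u : R) := u * (- s^-1) / (1 - u * (- s^-1)).
pose FD : R -> R := F \_ `[0, +oo[%classic.
have FDE u : 0 <= u -> FD u = s / (s + u) - 1.
  move=> u0; rewrite /FD patchE ifT; last by rewrite inE /= in_itv /= u0.
  by rewrite /F; field; rewrite !gt_eqF //; lra.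
have FD0 u : u < 0 -> FD u = 0.
  move=> u0; rewrite /FD patchE ifN // notin_setE /= in_itv /= andbT.
  by apply/negP; rewrite -ltNge.
have FD_itv u : -1 <= FD u <= 0.
  have [u0|u0] := ltP u 0; first by rewrite FD0 // lexx lerN10.
  rewrite FDE // lerBrDr addNr subr_le0 divr_ge0 //=; try lra.
  by rewrite ler_pdivrMr //; lra.
have mFD : measurable_fun setT FD.
  apply: nonincreasing_measurable => // u v uv.
  have [u0|u0] := ltP u 0; first by rewrite [leRHS]FD0 //; have /andP[] := FD_itv v.
  rewrite !FDE //; last exact: le_trans uv.
  rewrite lerB // ler_pM2l // lef_pV2 ?posrE; lra.
have -> : psi nu (- s^-1) = \int[nu]_u FD u by rewrite /psi Rintegral_mkcond.
rewrite (@Rintegral_uniform_distribution _ _ _ X FD 1) //; last first.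
  by move=> u; rewrite ler_norml; have /andP[-> h] := FD_itv u; rewrite (le_trans h).
rewrite (@eq_Rintegral _ _ _ U01 _ (fun p => stieltjes_kernel s (q p) + cst (-1) p)).
  rewrite RintegralD //.
  - by rewrite aE Rintegral_cst //= uniform_prob_itv //= subr0 mulr1.
  - exact: kernel_quantile_integrable.
  - by apply: (@uniform_integrable _ _ 1) => // p; rewrite /= normrN1.
move=> p; rewrite inE /= in_itv /= => /andP[_ p1].
have /andP[_ qp1] := q01 p.
rewrite -kernel_of_coord ?q_gt0 // XE /FD patchE ifT //.
by rewrite inE /= in_itv /= of_coord_ge0.
Qed.

(** Every [z < 0] is [- 1 / tilt a] for some [a], so [psi_law] describes [psi] on
    the whole negative half-line and uniqueness of the inverse follows. *)
Lemma psi_inv_law t : t \in `](-1), 0[ ->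
  psi_inv nu t = - (tilt beta gamma (1 + t))^-1.
Proof.
rewrite in_itv /= => /andP[t1 t0].
have a01 : 0 < 1 + t < 1 by apply/andP; split; lra.
rewrite /psi_inv; apply: xget_unique.
  split; last by rewrite psi_law //; ring.
  by rewrite oppr_lt0 invr_gt0 tilt_gt0.
move=> z [z0 psiz].
have Vz0 : 0 < - z^-1 by rewrite oppr_gt0 invr_lt0.
have [a a01' aE] := tilt_surj hbeta (ltW hgamma) Vz0.
have zE : z = - (tilt beta gamma a)^-1 by rewrite aE invrN opprK invrK.
have -> : 1 + t = a by rewrite -psiz zE psi_law //; ring.
exact: zE.
Qed.

Lemma S_transform_law t : t \in `](-1), 0[ ->
  S_transform nu t = expR (gamma / (t + beta + 1)).
Proof.
move=> t01; rewrite /S_transform psi_inv_law // /tilt invfM -expRN opprK.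
have -> : 1 + t + beta = t + beta + 1 by ring.
move: t01; rewrite in_itv /= => /andP[t1 t0].
have t1' : 1 + t != 0 by rewrite gt_eqF //; lra.
have -> : 1 - (1 + t) = - t by ring.
by field; rewrite t1' lt_eqF.
Qed.

Lemma Sigma_transform_law z : z \in `]-oo, 0[ ->
  Sigma_transform nu z = expR (gamma * (1 - z) / (1 + beta * (1 - z))).
Proof.
rewrite in_itv /= => z0; have z1 : 0 < 1 - z by lra.
rewrite /Sigma_transform S_transform_law; last first.
  rewrite in_itv /= ltr_pdivlMr // ltr_pdivrMr // mul0r z0 andbT; lra.
congr expR; rewrite -mulrA; congr (gamma * _).
have -> : z / (1 - z) + beta + 1 = (1 + beta * (1 - z)) / (1 - z).
  by field; rewrite gt_eqF.
by rewrite invf_div.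
Qed.

Lemma kernel_comb_integrable a l : all (fun x => 0 < x.2) l ->
  U01.-integrable `[0, 1[ (EFin \o (kernel_comb a l \o q)).
Proof.
move=> lpos; have mcomb : measurable_fun setT (kernel_comb a l \o q).
  rewrite /kernel_comb /comp; apply: measurable_funD => //.
  elim: l lpos => [_|x l IH /= /andP[x0 /IH ml]].
    by under eq_fun do rewrite big_nil; exact: measurable_cst.
  under eq_fun do rewrite big_cons.
  apply: measurable_funD => //.
  by apply: measurable_funM => //; exact: measurable_kernel_quantile.
apply: (uniform_integrable _ mcomb) => // p.
exact: (kernel_comb_bound a lpos (qm p)).
Qed.

Lemma Rintegral_kernel_comb a l : all (fun x => 0 < x.2) l ->
  \int[U01]_(p in `[0, 1[) kernel_comb a l (q p) =
    a + \sum_(x <- l) x.1 * \int[U01]_(p in `[0, 1[) stieltjes_kernel x.2 (q p).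
Proof.
elim: l => [_|x l IH /= /andP[x0 lpos]].
  rewrite big_nil addr0 (@eq_Rintegral _ _ _ U01 _ (cst a)).
    by rewrite Rintegral_cst //= uniform_prob_itv //= subr0 mulr1.
  by move=> p _; rewrite /kernel_comb big_nil addr0.
rewrite big_cons addrCA -(IH lpos) -RintegralZl //; last first.
  exact: kernel_quantile_integrable.
rewrite -RintegralD //; first last.
- exact: kernel_comb_integrable.
- apply: (@integrableZl _ _ _ U01 _ _ x.1 (EFin \o (stieltjes_kernel x.2 \o q))) => //.
  exact: kernel_quantile_integrable.
by apply: eq_Rintegral => p _; rewrite /kernel_comb big_cons; ring.
Qed.

Lemma kernel_comb_average_cvg (b : nat -> R) (c : nat -> nat) a l :
  (forall n, 0 <= b n \/ b n <= - n%:R) ->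
  b n / n%:R @[n --> \oo] --> beta ->
  (c n)%:R / n%:R @[n --> \oo] --> gamma ->
  all (fun x => 0 < x.2) l ->
  (\sum_(w <- zero_coords n (Ppoly n (b n) (c n)%:R)) kernel_comb a l w) / n%:R
    @[n --> \oo] --> \int[U01]_(p in `[0, 1[) kernel_comb a l (q p).
Proof.
move=> hb cvgb cvgc lpos; rewrite Rintegral_kernel_comb //.
have lim : a + \sum_(x <- l) x.1 * scaled_mean n (b n) (c n) x.2 @[n --> \oo] -->
    a + \sum_(x <- l) x.1 * \int[U01]_(p in `[0, 1[) stieltjes_kernel x.2 (q p).
  apply: cvgD; first exact: cvg_cst.
  elim: l lpos => [_|x l IH /= /andP[x0 /IH liml]].
    by rewrite big_nil; under eq_fun do rewrite big_nil; exact: cvg_cst.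
  rewrite big_cons; under eq_fun do rewrite big_cons.
  apply: cvgD => //; apply: cvgM; first exact: cvg_cst.
  have [k k01 <-] := tilt_surj hbeta (ltW hgamma) x0.
  by rewrite qE //; exact: scaled_mean_cvg (ltW hgamma) cvgb cvgc k01.
apply: cvg_trans lim; apply: near_eq_cvg; near=> n.
have n0 : (0 < n)%N by near: n; exists 1%N.
have nR : n%:R != 0 :> R by rewrite pnatr_eq0 -lt0n.
rewrite /kernel_comb big_split /= big_const_seq count_predT iter_addr_0.
rewrite size_zero_coords // -[a *+ n]mulr_natr mulrDl mulfK //; congr (_ + _).
rewrite exchange_big big_distrl /=; apply: eq_big_seq => x xl.
by rewrite -big_distrr /= -mulrA kernel_average //; exact: (allP lpos).
Unshelve. all: by end_near.
Qed.

(** In the coordinate [w], a test function on the sphere is uniformly close to a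
    combination of kernels, for which [kernel_comb_average_cvg] gives the
    convergence of the averages. *)
Lemma weak_cvg_law (b : nat -> R) (c : nat -> nat) :
  (forall n, 0 <= b n \/ b n <= - n%:R) ->
  b n / n%:R @[n --> \oo] --> beta ->
  (c n)%:R / n%:R @[n --> \oo] --> gamma ->
  weak_cvg
    (fun n => zero_distribution n (map_poly rc (Ppoly n (b n) (c n)%:R)))
    (distribution nu sphere_of_real).
Proof.
move=> hb cvgb cvgc f cf [M0 [_ bf]].
have fM x : `|f x| <= M0 + 1 by apply: bf => //; rewrite ltrDl.
set M := M0 + 1 in fM.
have mf := measurable_sphere_continuous cf.
have mfS : measurable_fun setT ((f : Borel (sphere R) -> R) \o sphere_of_real).
  exact: measurableT_comp.
pose F p := f (sphere_of_real (X p)).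
have -> : \int[distribution nu sphere_of_real]_x f x = \int[U01]_(p in `[0, 1[) F p.
  rewrite /Rintegral integral_distribution; last 2 first.
  - exact/measurable_EFinP.
  - apply: measurable_bounded_integrable => //.
      by apply: le_lt_trans (probability_le1 nu measurableT) _; rewrite ltry.
    exists M; split; rewrite ?num_real // => x Mx y _ /=.
    by rewrite (le_trans (fM _)) // ltW.
  exact: (Rintegral_uniform_distribution X mfS (fun t => fM _)).
have mF : measurable_fun setT F by exact: (measurableT_comp mfS).
have intF : U01.-integrable `[0, 1[ (EFin \o F).
  by apply: (uniform_integrable _ mF) => // p; exact: fM.
pose g := sphere_coord f.
have gF p : p \in `[0, 1[ -> F p = g (q p).
  rewrite in_itv /= => /andP[_ p1]; have qp0 := q_gt0 p1.
  by rewrite /g /sphere_coord gt_eqF // /F XE of_coordE.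
have ga : kernel_approx g.
  apply: (@kernel_approx_continuous _ _ M); last exact: sphere_coord_continuous.
  by move=> w _; rewrite /g /sphere_coord; case: eqP => _; exact: fM.
apply/cvgrPdist_le => eps eps0; have e3 : 0 < eps / 3 by lra.
have [a [l [lpos gl]]] := ga _ e3.
have dint : `|\int[U01]_(p in `[0, 1[) F p -
    \int[U01]_(p in `[0, 1[) kernel_comb a l (q p)| <= eps / 3.
  have intc := kernel_comb_integrable a lpos.
  have intd : U01.-integrable `[0, 1[
      (EFin \o (fun p => F p - kernel_comb a l (q p))).
    by exact: (integrableB _ intF intc).
  rewrite -RintegralB //; apply: le_trans (le_normr_Rintegral _ _) _ => //.
  apply: (@le_trans _ _ (\int[U01]_(p in `[0, 1[) (cst (eps / 3) p))).
    apply: le_Rintegral => //.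
    - exact: (integrable_norm intd).
    - by apply: (@uniform_integrable _ _ (eps / 3)) => // p; rewrite /= gtr0_norm.
    - by move=> p p01 /=; rewrite gF //; exact: gl.
  by rewrite Rintegral_cst //= uniform_prob_itv //= subr0 mulr1.
have /cvgrPdist_le/(_ _ e3) := @kernel_comb_average_cvg b c a l hb cvgb cvgc lpos.
move=> near_comb; near=> n.
have n0 : (0 < n)%N by near: n; exists 1%N.
have nR : 0 < n%:R :> R by rewrite ltr0n.
have davg' : `|\int[U01]_(p in `[0, 1[) kernel_comb a l (q p) -
    (\sum_(w <- zero_coords n (Ppoly n (b n) (c n)%:R)) kernel_comb a l w) /
    n%:R| <= eps / 3 by near: n; exact: near_comb.
rewrite (sphere_coord_average (c n) n0 (hb n) mf fM) -/g.
set ws := zero_coords _ _ in davg' *.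
have davg : `|(\sum_(w <- ws) kernel_comb a l w) / n%:R - (\sum_(w <- ws) g w) / n%:R|
    <= eps / 3.
  rewrite -mulrBl -sumrB normrM normfV (gtr0_norm nR) ler_pdivrMr //.
  rewrite (le_trans (ler_norm_sum _ _ _)) //.
  have -> : eps / 3 * n%:R = \sum_(w <- ws) eps / 3.
    by rewrite big_const_seq count_predT iter_addr_0 size_zero_coords // mulr_natr.
  rewrite !big_seq; apply: ler_sum => w wws; rewrite distrC.
  by apply: gl; exact: zero_coords_itv wws.
set A := \int[U01]_(p in _) F p in dint *.
set B := \int[U01]_(p in _) kernel_comb a l (q p) in dint davg' *.
set C := (\sum_(w <- ws) kernel_comb a l w) / n%:R in davg davg' *.
set D := (\sum_(w <- ws) g w) / n%:R in davg *.
have -> : A - D = (A - B) + ((B - C) + (C - D)) by ring.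
apply: le_trans (ler_normD _ _) _; have := ler_normD (B - C) (C - D).
lra.
Unshelve. all: by end_near.
Qed.

End conclusion.

Theorem theorem5p12 (R : realType) (beta gamma : R)
    (hbeta : beta \notin `](-1), 0[) (hgamma : 0 < gamma) :
  exists nu : probability (measurableTypeR R) R,
    [/\ nu `[0, +oo[%classic = 1%E,
        forall t : R, t \in `](-1), 0[ ->
          S_transform nu t = expR (gamma / (t + beta + 1)),
        forall z : R, z \in `]-oo, 0[ ->
          Sigma_transform nu z =
            expR (gamma * (1 - z) / (1 + beta * (1 - z)))
      & forall (b : nat -> R) (c : nat -> nat),
          (forall n : nat, b n \notin `](- n%:R), 0[) ->
          b n / n%:R @[n --> \oo] --> beta ->
          (c n)%:R / n%:R @[n --> \oo] --> gamma ->
          weak_cvg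
            (fun n => zero_distribution n
               (map_poly (real_complex R) (Ppoly n (b n) (c n)%:R)))
            (distribution nu sphere_of_real)].
Proof.
have [q [q_ni q01 qE]] := limit_law hbeta hgamma.
pose X : {mfun measurableTypeR R >-> measurableTypeR R} :=
  @mfun_Sub _ _ (measurableTypeR R) (measurableTypeR R) _
    (mem_set (measurable_of_coord q_ni)).
pose nu : probability (measurableTypeR R) R := distribution (uniform_prob (@ltr01 R)) X.
exists nu; split.
- by apply: (law_nonneg q01).
- by apply: (S_transform_law hbeta hgamma q_ni q01 qE).
- by apply: (Sigma_transform_law hbeta hgamma q_ni q01 qE).
- move=> b c hb; apply: (weak_cvg_law hbeta hgamma q_ni q01 qE) => // n.
  have := hb n; rewrite in_itv /= negb_and -!leNgt.
  by move=> /orP[h|h]; [right|left].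
Qed.
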